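(* If $f:X\to Y$ is a hypercover of simplicial manifolds, then $f^*:H^\bullet(Y)\to H^\bullet(X)$ is an isomorphism.
   Context: A simplicial manifold is a contravariant functor $X$ from the category of finite ordinals $[n]=\{0,\dots,n\}$ to smooth manifolds, with faces $d_i:X_n\to X_{n-1}$ and degeneracies $s_j$; maps of simplicial manifolds are smooth in each degree. For a simplicial set $K$, $X^K=\hom(K,X)$ is the set of simplicial maps $K\to X$; $X^{\Delta^n}=X_n$. For a map $f:X\to Y$ of simplicial manifolds and an inclusion $K\to L$ of finite simplicial sets, $X^K\times_{Y^K}Y^L$ is the space of commutative squares given by maps $\phi:K\to X$, $\psi:L\to Y$ with $f\phi=\psi|_K$. It is said to be smooth if this (iterated) limit, which always exists in topological spaces, also exists in manifolds and has the right topology; concretely, if $K$ is spanned by simplices $\sigma_i\in K_{n_i}$ and $L$ is spanned by the $\sigma_i$ together with $\tau_j\in L_{n_j}\setminus K$ (finitely many), this means that $(\phi,\psi)\mapsto((\phi(\sigma_i))_i,(\psi(\tau_j))_j)$ identifies it with an embedded submanifold of $\prod_iX_{n_i}\times\prod_jY_{n_j}$. $f$ is a hypercover if for all $n\ge0$ the relative matching space $X^{\partial\Delta^n}\times_{Y^{\partial\Delta^n}}Y_n$ is smooth and the restriction map $\partial_n:X_n\to X^{\partial\Delta^n}\times_{Y^{\partial\Delta^n}}Y_n$ is a surjective submersion. (For $n=0$, $\partial\Delta^0=\emptyset$ and $\partial_0=f_0:X_0\to Y_0$.) $H^\bullet(X)$ is the cohomology of the cochain complex $C(X)=\bigoplus_{n\ge0}C^\infty(X_n)$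 with differential $\delta(f)=(-1)^{n+1}\sum_{i=0}^{n+1}(-1)^if\circ d_i$ for $f\in C^\infty(X_n)$. The map $f^*$ is induced by pullback of functions along $f_n:X_n\to Y_n$. *)

(* Defs.v *)
From HB Require Import structures.
From Stdlib Require List.
From mathcomp Require Import all_boot all_order all_algebra.
From mathcomp Require Import all_classical all_reals.
From mathcomp Require Import topology normedtype landau derive zify lra.

Set Implicit Arguments.
Unset Strict Implicit.
Unset Printing Implicit Defensive.

Import Order.TTheory GRing.Theory Num.Theory.
Import numFieldNormedType.Exports.

Local Open Scope classical_set_scope.
Local Open Scope ring_scope.

Section Smoothness.
Variable R : realType.
Implicit Types V W : normedModType R.

(* Meant for open [U]: [f] is [k] times continuously differentiable on [U]
   (Frechet differentiability, with continuity of the [k]-th directional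
   derivatives); the values of [f] outside [U] play no role. *)
Fixpoint Ck V W (k : nat) (U : set V) (f : V -> W) : Prop :=
  match k with
  | 0 => forall x, U x -> {for x, continuous f}
  | k'.+1 => (forall x, U x -> differentiable f x) /\
             (forall v, Ck k' U ('D_v f))
  end.

Definition Cinfty V W (U : set V) (f : V -> W) : Prop :=
  forall k, Ck k U f.

Lemma Ck_cst V W k (U : set V) (a : W) : Ck k U (cst a).
Proof.
elim: k a => [|k IHk] a /=; first by move=> x _; exact: cst_continuous.
split=> [x _|v]; first exact: differentiable_cst.
have -> : 'D_v (cst a : V -> W) = cst 0 by apply/funext=> x; rewrite derive_cst.
exact: IHk.
Qed.

Lemma Ck_subset V W k (U U' : set V) (f : V -> W) :
  U' `<=` U -> Ck k U f -> Ck k U' f.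
Proof.
move=> UU'; elim: k f => [|k IHk] f /=; first by move=> h x /UU' /h.
by move=> [df h]; split=> [x /UU' /df//|v]; exact: IHk.
Qed.

Lemma Ck_local V W k (U : set V) (f : V -> W) :
  (forall x, U x -> exists2 U', U' x & Ck k U' f) -> Ck k U f.
Proof.
elim: k f => [|k IHk] f h /=; first by move=> x /h[U' U'x]; exact.
split=> [x /h[U' U'x [df _]]|v]; first exact: df.
by apply: IHk => x /h[U' U'x [_ /(_ v)]]; exists U'.
Qed.

Lemma CkW V W k (U : set V) (f : V -> W) : Ck k.+1 U f -> Ck k U f.
Proof.
elim: k f => [|k IHk] f /= [df h].
  by move=> x Ux; exact/differentiable_continuous/df.
by split=> // v; apply: IHk; exact: h.
Qed.

Lemma near_eq_differentiable V W (f g : V -> W) x :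
  (\near x, f x = g x) -> differentiable f x -> differentiable g x.
Proof.
move=> fg df.
have fgx := nbhs_singleton fg.
have hd : continuous ('d f x) /\
    g \o shift x = cst (g x) + 'd f x +o_ (0 : V) id.
  split; first exact: diff_continuous.
  apply/eqaddoP => e e0.
  have /eqaddoP/(_ e e0) := diff_locally df.
  apply: filterS2; last first.
    have : \forall y \near (0:V), f (y + x) = g (y + x).
      by move: fg; rewrite (near_shift 0 x) subr0.
    exact.
  by move=> y /= yx; rewrite !fctE /= yx fgx.
apply/diff_locallyP.
by rewrite (diff_unique hd.1 hd.2).
Qed.

Lemma Ck_ext V W k (U : set V) (f g : V -> W) :
  open U -> (forall x, U x -> f x = g x) -> Ck k U f -> Ck k U g.
Proof.
move=> oU.
have nU (f' g' : V -> W) x : (forall x, U x -> f' x = g' x) -> U x ->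
    \forall y \near x, f' y = g' y.
  by move=> fg Ux; near=> y; apply: fg; near: y; exact: open_nbhs_nbhs.
elim: k f g => [|k IHk] f g fg /=.
  move=> h x Ux; have : g y @[y --> x] --> f x.
    by apply: cvg_trans (h x Ux); apply: near_eq_cvg; exact: nU.
  by rewrite (fg _ Ux).
move=> [df h]; split=> [x Ux|v].
  exact: near_eq_differentiable (nU _ _ _ fg Ux) (df x Ux).
apply: IHk (h v) => x Ux; exact/near_eq_derive/nU.
Unshelve. all: by end_near. Qed.

Lemma CkD V W k (U : set V) (f g : V -> W) :
  open U -> Ck k U f -> Ck k U g -> Ck k U (f + g).
Proof.
move=> oU; elim: k f g => [|k IHk] f g /= Cf Cg.
  by move=> x Ux; apply: continuousD; [exact: Cf|exact: Cg].
case: Cf Cg => [df hf] [dg hg]; split=> [x Ux|v].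
  by apply: differentiableD; [exact: df|exact: dg].
apply: (@Ck_ext _ _ _ _ ('D_v f + 'D_v g)) => //; last exact: IHk.
move=> x Ux; rewrite deriveD//; apply: diff_derivable; [exact: df|exact: dg].
Qed.

Lemma CkZ V W k (U : set V) (a : R) (f : V -> W) :
  open U -> Ck k U f -> Ck k U (a *: f).
Proof.
move=> oU; elim: k f => [|k IHk] f /= Cf.
  by move=> x Ux; apply: continuousZl_tmp; exact: Cf.
case: Cf => [df hf]; split=> [x Ux|v].
  by apply: differentiableZ; exact: df.
apply: (@Ck_ext _ _ _ _ (a *: 'D_v f)) => //; last exact: IHk.
by move=> x Ux; rewrite deriveZ//; apply: diff_derivable; exact: df.
Qed.

Lemma CkM V k (U : set V) (f g : V -> R^o) :
  open U -> Ck k U f -> Ck k U g -> Ck k U (f * g : V -> R^o).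
Proof.
move=> oU; elim: k f g => [|k IHk] f g /= Cf Cg.
  by move=> x Ux; apply: continuousM; [exact: Cf|exact: Cg].
have [Cf' Cg'] := (CkW (conj Cf.1 Cf.2), CkW (conj Cg.1 Cg.2)).
case: Cf Cg => [df hf] [dg hg]; split=> [x Ux|v].
  by apply: differentiableM; [exact: df|exact: dg].
apply: (@Ck_ext _ _ _ _ ((f * 'D_v g : V -> R^o) + (g * 'D_v f : V -> R^o))) => //.
  move=> x Ux; rewrite deriveM//; apply: diff_derivable; [exact: df|exact: dg].
by apply: CkD => //; apply: IHk.
Qed.

Lemma Ck_sum V W k (U : set V) n (f : 'I_n -> V -> W) :
  open U -> (forall i, Ck k U (f i)) -> Ck k U (\sum_(i < n) f i).
Proof.
move=> oU h; elim/big_ind : _ => //; first exact: (@Ck_cst _ _ _ _ 0).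
by move=> ? ?; exact: CkD.
Qed.

Lemma Ck_linear_comp V W W' k (U : set V) (L : {linear W -> W'}) (f : V -> W) :
  continuous L -> open U -> Ck k U f -> Ck k U (L \o f).
Proof.
move=> cL oU; elim: k f => [|k IHk] f /= Cf.
  by move=> x Ux; apply: continuous_comp; [exact: Cf|exact: cL].
case: Cf => [df hf]; split=> [x Ux|v].
  by apply: differentiable_comp; [exact: df|exact: linear_differentiable].
apply: (@Ck_ext _ _ _ _ (L \o 'D_v f)) => //; last exact: IHk.
move=> x Ux; rewrite deriveE; last first.
  by apply: differentiable_comp; [exact: df|exact: linear_differentiable].
rewrite diff_comp; [|exact: df|exact: linear_differentiable].
by rewrite /= diff_lin// deriveE//; exact: df.
Qed.

Lemma Ck_comp_linear V V' W k (U : set V) (L : {linear V' -> V}) (f : V -> W) :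
  continuous L -> open U -> Ck k U f -> Ck k (L @^-1` U) (f \o L).
Proof.
move=> cL oU; have oLU : open (L @^-1` U) by exact: open_comp.
elim: k f => [|k IHk] f /= Cf.
  by move=> x Ux; apply: continuous_comp; [exact: cL|exact: Cf].
case: Cf => [df hf]; split=> [x Ux|v].
  by apply: differentiable_comp; [exact: linear_differentiable|exact: df].
apply: (@Ck_ext _ _ _ _ ('D_(L v) f \o L)) => //; last exact: IHk.
move=> x Ux; rewrite [RHS]deriveE; last first.
  by apply: differentiable_comp; [exact: linear_differentiable|exact: df].
rewrite diff_comp; [|exact: linear_differentiable|exact: df].
by rewrite /= diff_lin// deriveE//; exact: df.
Qed.

Lemma Ck_comp V n k (U : set V) (U' : set 'rV[R]_n)
    (f : 'rV[R]_n -> R^o) (g : V -> 'rV[R]_n) :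
  open U -> (forall x, U x -> U' (g x)) -> Ck k U' f -> Ck k U g ->
  Ck k U (f \o g).
Proof.
move=> oU gU; elim: k f => [|k IHk] f /= Cf Cg.
  by move=> x Ux; apply: continuous_comp; [exact: Cg|exact/Cf/gU].
have Cg' := CkW (conj Cg.1 Cg.2).
case: Cf Cg => [df hf] [dg hg]; split=> [x Ux|v].
  by apply: differentiable_comp; [exact: dg|exact/df/gU].
pose coord (j : 'I_n) (u : 'rV[R]_n) : R^o := u 0 j.
have lc j : linear (coord j) by move=> a u w; rewrite /coord !mxE.
pose cL j : {linear 'rV[R]_n -> R^o} :=
  HB.pack (coord j) (GRing.isLinear.Build _ _ _ _ _ (lc j)).
pose F (j : 'I_n) : V -> R^o :=
  (('D_(delta_mx 0 j) f \o g : V -> R^o) * (cL j \o 'D_v g : V -> R^o)).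
apply: (@Ck_ext _ _ _ _ (\sum_(j < n) F j)) => //.
  move=> x Ux; rewrite fct_sumE [RHS]deriveE; last first.
    by apply: differentiable_comp; [exact: dg|exact/df/gU].
  rewrite diff_comp; [|exact: dg|exact/df/gU].
  rewrite /= -(deriveE _ (dg _ Ux)) [X in 'd f _ X]row_sum_delta linear_sum.
  apply: eq_bigr => j _.
  rewrite linearZ /F /= fctE /= -deriveE; last exact/df/gU.
  by rewrite mulrC.
apply: Ck_sum => // j; apply: CkM => //; first exact: IHk.
by apply: Ck_linear_comp => //; exact: coord_continuous.
Qed.

End Smoothness.

Section Manifold.
Variable R : realType.

(* [chart_map] and [chart_inv] are total functions that only matter on
   [chart_dom] and [chart_img].  The dimension belongs to the chart: the
   components of a manifold may have different dimensions.  The empty space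
   has no chart, and is a manifold with the empty atlas. *)
Record chart (T : topologicalType) := Chart {
  chart_dim : nat;
  chart_dom : set T;
  chart_img : set 'rV[R]_chart_dim;
  chart_map : T -> 'rV[R]_chart_dim;
  chart_inv : 'rV[R]_chart_dim -> T;
  chart_dom_open : open chart_dom;
  chart_img_open : open chart_img;
  chart_mapP : forall x, chart_dom x -> chart_img (chart_map x);
  chart_invP : forall v, chart_img v -> chart_dom (chart_inv v);
  chart_mapK : forall x, chart_dom x -> chart_inv (chart_map x) = x;
  chart_invK : forall v, chart_img v -> chart_map (chart_inv v) = v;
  chart_map_cont : forall x, chart_dom x -> {for x, continuous chart_map};
  chart_inv_cont : forall v, chart_img v -> {for v, continuous chart_inv}
}.

Arguments chart_map {T} c _.
Arguments chart_inv {T} c _.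
Arguments chart_dom {T} c _.
Arguments chart_img {T} c _.

(* The atlas need not be maximal. *)
Record manifold := Manifold {
  carrier :> topologicalType;
  atlas : set (chart carrier);
  atlas_cover : forall x, exists2 c, atlas c & chart_dom c x;
  atlas_compat : forall c c', atlas c -> atlas c' ->
    Cinfty [set v | chart_img c v /\ chart_dom c' (chart_inv c v)]
           (chart_map c' \o chart_inv c);
  manifold_hausdorff : hausdorff_space carrier;
  manifold_second_countable : @second_countable carrier
}.

Definition in_charts (M N : manifold) (g : M -> N) (c : chart M) (c' : chart N) :
  'rV[R]_(chart_dim c) -> 'rV[R]_(chart_dim c') :=
  chart_map c' \o g \o chart_inv c.

Arguments in_charts {M N} g c c' _.

Definition smooth_map (M N : manifold) (g : M -> N) : Prop :=
  continuous g /\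
  forall c c', atlas c -> atlas c' ->
    Cinfty [set v | chart_img c v /\ chart_dom c' (g (chart_inv c v))]
           (in_charts g c c').

Definition submersion (M N : manifold) (g : M -> N) : Prop :=
  smooth_map g /\
  forall x c c', atlas c -> atlas c' -> chart_dom c x -> chart_dom c' (g x) ->
    forall w, exists v, 'd (in_charts g c c') (chart_map c x) v = w.

Definition immersion (M N : manifold) (g : M -> N) : Prop :=
  smooth_map g /\
  forall x c c', atlas c -> atlas c' -> chart_dom c x -> chart_dom c' (g x) ->
    injective ('d (in_charts g c c') (chart_map c x)).

(* An embedded submanifold is the image of such a map. *)
Definition smooth_embedding (M N : manifold) (g : M -> N) : Prop :=
  [/\ immersion g, injective g &
      forall U : set M, open U -> exists2 V : set N, open V & U = g @^-1` V].

Definition smooth_fun_set (M : manifold) (h : M -> R) : Prop :=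
  forall c, atlas c -> Cinfty (chart_img c) (h \o chart_inv c : _ -> R^o).

Lemma continuous_at_mx (T : topologicalType) m n (f : T -> 'M[R]_(m, n)) x :
  (forall i j, {for x, continuous (fun y => f y i j)}) -> {for x, continuous f}.
Proof.
move=> h A [P hP PA].
have : \forall y \near x, forall i j, P i j (f y i j).
  apply: filter_forall => i; apply: filter_forall => j.
  exact: (h i j _ (hP i j)).
by apply: filterS => y hy; apply: PA.
Qed.

Lemma continuous_at_row_mx (T : topologicalType) m n
    (f : T -> 'rV[R]_m) (g : T -> 'rV[R]_n) x :
  {for x, continuous f} -> {for x, continuous g} ->
  {for x, continuous (fun y => row_mx (f y) (g y))}.
Proof.
move=> cf cg; apply: continuous_at_mx => i j.
case: (split_ordP j) => k ->.
  rewrite (_ : (fun _ => _) = (fun u : 'rV[R]_m => u i k) \o f); last first.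
    by apply/funext => y; rewrite row_mxEl.
  by apply: continuous_comp => //; exact: coord_continuous.
rewrite (_ : (fun _ => _) = (fun u : 'rV[R]_n => u i k) \o g); last first.
  by apply/funext => y; rewrite row_mxEr.
by apply: continuous_comp => //; exact: coord_continuous.
Qed.

Lemma continuous_row_mx0 m n :
  continuous (fun u : 'rV[R]_m => row_mx u (0 : 'rV[R]_n)).
Proof.
move=> x; apply: (continuous_at_row_mx (f := id)); first exact: cvg_id.
exact: cst_continuous.
Qed.

Lemma continuous_row_0mx m n :
  continuous (fun u : 'rV[R]_n => row_mx (0 : 'rV[R]_m) u).
Proof.
move=> x; apply: (continuous_at_row_mx (g := id)); last exact: cvg_id.
exact: cst_continuous.
Qed.

Lemma Ck_row_mx (V : normedModType R) m n k (U : set V)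
    (f : V -> 'rV[R]_m) (g : V -> 'rV[R]_n) :
  open U -> Ck k U f -> Ck k U g -> Ck k U (fun x => row_mx (f x) (g x)).
Proof.
move=> oU Cf Cg.
have l1 : linear (fun u : 'rV[R]_m => row_mx u (0 : 'rV[R]_n)).
  by move=> a u v; rewrite scale_row_mx add_row_mx scaler0 addr0.
have l2 : linear (fun u : 'rV[R]_n => row_mx (0 : 'rV[R]_m) u).
  by move=> a u v; rewrite scale_row_mx add_row_mx scaler0 addr0.
pose L1 : {linear 'rV[R]_m -> 'rV[R]_(m + n)} :=
  HB.pack (fun u : 'rV[R]_m => row_mx u (0 : 'rV[R]_n))
    (GRing.isLinear.Build _ _ _ _ _ l1).
pose L2 : {linear 'rV[R]_n -> 'rV[R]_(m + n)} :=
  HB.pack (fun u : 'rV[R]_n => row_mx (0 : 'rV[R]_m) u)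
    (GRing.isLinear.Build _ _ _ _ _ l2).
have -> : (fun x => row_mx (f x) (g x)) = (L1 \o f) + (L2 \o g).
  apply/funext => x; rewrite fctE /= add_row_mx addr0 add0r//.
apply: CkD => //; apply: Ck_linear_comp => //.
  exact: continuous_row_mx0.
exact: continuous_row_0mx.
Qed.

Section Product.
Variables (M N : topologicalType) (c : chart M) (c' : chart N).

Let D := chart_dom c `*` chart_dom c'.
Let I : set 'rV[R]_(chart_dim c + chart_dim c') :=
  [set v | chart_img c (lsubmx v) /\ chart_img c' (rsubmx v)].
Let F (x : M * N) := row_mx (chart_map c x.1) (chart_map c' x.2).
Let G (v : 'rV[R]_(chart_dim c + chart_dim c')) :=
  (chart_inv c (lsubmx v), chart_inv c' (rsubmx v)).

Fact prod_chart_dom_open : open D.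
Proof.
have -> : D = (fst @^-1` chart_dom c) `&` (snd @^-1` chart_dom c').
  by apply/seteqP; split.
apply: openI; apply: open_comp => //; try exact: chart_dom_open.
  by move=> x _; exact: cvg_fst.
by move=> x _; exact: cvg_snd.
Qed.

Fact prod_chart_img_open : open I.
Proof.
have -> : I = (lsubmx @^-1` chart_img c) `&` (rsubmx @^-1` chart_img c').
  by apply/seteqP; split.
apply: openI; apply: open_comp => //; try exact: chart_img_open.
  by move=> x _; exact: continuous_lsubmx.
by move=> x _; exact: continuous_rsubmx.
Qed.

Fact prod_chart_mapP x : D x -> I (F x).
Proof.
by case=> Dx Dx'; split; rewrite /F ?row_mxKl ?row_mxKr; exact: chart_mapP.
Qed.

Fact prod_chart_invP v : I v -> D (G v).
Proof. by case=> Iv Iv'; split; exact: chart_invP. Qed.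

Fact prod_chart_mapK x : D x -> G (F x) = x.
Proof.
by case: x => x y [Dx Dx']; rewrite /G /F row_mxKl row_mxKr !chart_mapK.
Qed.

Fact prod_chart_invK v : I v -> F (G v) = v.
Proof. by case=> Iv Iv'; rewrite /F /G !chart_invK// hsubmxK. Qed.

Fact prod_chart_map_cont x : D x -> {for x, continuous F}.
Proof.
case=> Dx Dx'; apply: continuous_at_row_mx.
  apply: (@continuous_comp _ _ _ fst (chart_map c)); first exact: cvg_fst.
  exact: chart_map_cont.
apply: (@continuous_comp _ _ _ snd (chart_map c')); first exact: cvg_snd.
exact: chart_map_cont.
Qed.

Fact prod_chart_inv_cont v : I v -> {for v, continuous G}.
Proof.
case=> Iv Iv'.
have cl : {for v, continuous (chart_inv c \o lsubmx)}.
  by apply: continuous_comp; [exact: continuous_lsubmx|exact: chart_inv_cont].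
have cr : {for v, continuous (chart_inv c' \o rsubmx)}.
  by apply: continuous_comp; [exact: continuous_rsubmx|exact: chart_inv_cont].
exact: cvg_pair cl cr.
Qed.

Definition prod_chart : chart (M * N)%type :=
  Chart prod_chart_dom_open prod_chart_img_open prod_chart_mapP
    prod_chart_invP prod_chart_mapK prod_chart_invK
    prod_chart_map_cont prod_chart_inv_cont.

End Product.

Section ProductManifold.
Variables M N : manifold.

Definition prod_atlas : set (chart (M * N)%type) :=
  [set d | exists c c', [/\ atlas c, atlas c' & d = prod_chart c c']].

Fact prod_atlas_cover x : exists2 d, prod_atlas d & chart_dom d x.
Proof.
have [c cA cx] := atlas_cover x.1; have [c' cA' cx'] := atlas_cover x.2.
by exists (prod_chart c c'); [exists c, c'|split].
Qed.

Lemma overlap_open (T : topologicalType) (c d : chart T) :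
  open [set v | chart_img c v /\ chart_dom d (chart_inv c v)].
Proof.
have -> : [set v | chart_img c v /\ chart_dom d (chart_inv c v)] =
   chart_img c `&` (chart_inv c @^-1` chart_dom d) by apply/seteqP; split.
rewrite openE => v [cv dv]; apply: filterI.
  exact: (open_nbhs_nbhs (conj (@chart_img_open _ c) cv)).
apply: chart_inv_cont => //.
exact: (open_nbhs_nbhs (conj (@chart_dom_open _ d) dv)).
Qed.

Fact prod_atlas_compat d d' : prod_atlas d -> prod_atlas d' ->
  Cinfty [set v | chart_img d v /\ chart_dom d' (chart_inv d v)]
         (chart_map d' \o chart_inv d).
Proof.
move=> [c [e [cA eA ->]]] [c' [e' [cA' eA' ->]]] k.
apply: (@Ck_row_mx _ _ _ _ _
  (chart_map c' \o chart_inv c \o lsubmx)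
  (chart_map e' \o chart_inv e \o rsubmx)).
- exact: (@overlap_open _ (prod_chart c e) (prod_chart c' e')).
- apply: Ck_subset (Ck_comp_linear _ _ (atlas_compat cA cA' k)).
  + by move=> v [[? ?] [? ?]]; split.
  + exact: continuous_lsubmx.
  + exact: overlap_open.
- apply: Ck_subset (Ck_comp_linear _ _ (atlas_compat eA eA' k)).
  + by move=> v [[? ?] [? ?]]; split.
  + exact: continuous_rsubmx.
  + exact: overlap_open.
Qed.

Fact prod_hausdorff : hausdorff_space (M * N)%type.
Proof.
move=> p q cl; have hM := @manifold_hausdorff M; have hN := @manifold_hausdorff N.
rewrite [p]surjective_pairing [q]surjective_pairing; congr pair.
  apply: hM => A B nA nB.
  have pA : nbhs p (fst @^-1` A).
    exact: (@cvg_fst _ _ (nbhs p.1) (nbhs p.2) _ A nA).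
  have qB : nbhs q (fst @^-1` B).
    exact: (@cvg_fst _ _ (nbhs q.1) (nbhs q.2) _ B nB).
  by have [x [Ax Bx]] := cl _ _ pA qB; exists x.1.
apply: hN => A B nA nB.
have pA : nbhs p (snd @^-1` A).
  exact: (@cvg_snd _ _ (nbhs p.1) (nbhs p.2) _ A nA).
have qB : nbhs q (snd @^-1` B).
  exact: (@cvg_snd _ _ (nbhs q.1) (nbhs q.2) _ B nB).
by have [x [Ax Bx]] := cl _ _ pA qB; exists x.2.
Qed.

Fact prod_second_countable : @second_countable (M * N)%type.
Proof.
have [A cA [oA bA]] := @manifold_second_countable M.
have [B cB [oB bB]] := @manifold_second_countable N.
exists ((fun p : set M * set N => p.1 `*` p.2) @` (A `*` B)).
  apply: (@sub_countable _ _ _ (A `*` B)); first exact: card_image_le.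
  exact: countableX.
split=> [_ [[U V] [/= AU BV] <-]|].
  have -> : U `*` V = (fst @^-1` U) `&` (snd @^-1` V) by apply/seteqP; split.
  apply: openI; apply: open_comp; try by [exact: oA|exact: oB].
    by move=> x _; exact: cvg_fst.
  by move=> x _; exact: cvg_snd.
move=> x W [[P Q] [/= nP nQ] PQW].
have [U [AU Ux] UP] := bA _ _ nP; have [V [BV Vx] VQ] := bB _ _ nQ.
exists (U `*` V); last by move=> y [Uy Vy]; apply: PQW; split; [exact: UP|exact: VQ].
by split; [exists (U, V)|split].
Qed.

Definition prod_manifold : manifold :=
  Manifold prod_atlas_cover prod_atlas_compat prod_hausdorff
    prod_second_countable.

End ProductManifold.

Fact point_chart_cont (x : 'rV[R]_0) : setT x -> {for x, continuous id}.
Proof. by move=> _; exact: cvg_id. Qed.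

Definition point_chart : chart 'rV[R]_0 :=
  @Chart _ 0 setT setT id id openT openT (fun _ => id) (fun _ => id)
    (fun _ _ => erefl) (fun _ _ => erefl) point_chart_cont point_chart_cont.

Fact point_compat (c d : chart 'rV[R]_0) :
  [set point_chart] c -> [set point_chart] d ->
  Cinfty [set v | chart_img c v /\ chart_dom d (chart_inv c v)]
         (chart_map d \o chart_inv c).
Proof.
move=> -> -> k; rewrite (_ : _ \o _ = cst 0); first exact: Ck_cst.
by apply/funext => v; exact: thinmx0.
Qed.

Fact point_cover (x : 'rV[R]_0) : exists2 c, [set point_chart] c & chart_dom c x.
Proof. by exists point_chart. Qed.

Fact point_second_countable : @second_countable 'rV[R]_0.
Proof.
exists [set setT]; first exact: countable1.
split=> [_ ->|x A nA]; first exact: openT.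
exists setT => // y _; rewrite (thinmx0 y) -(thinmx0 x).
exact: nbhs_singleton.
Qed.

Definition point_manifold : manifold :=
  Manifold point_cover point_compat (@norm_hausdorff _ _)
    point_second_countable.

End Manifold.

Arguments chart_map {R T} c _.
Arguments chart_inv {R T} c _.
Arguments chart_dom {R T} c _.
Arguments chart_img {R T} c _.
Arguments in_charts {R M N} g c c' _.

Section QuotientModule.
Local Open Scope quotient_scope.
Variable R : pzRingType.

Section Def.
Variables (V : lmodType R) (S : {pred V}) (SP : submod_closed S).

Definition submod_pred of submod_closed S : V -> bool := fun u => u \in S.

HB.instance Definition _ :=
  GRing.isSubmodClosed.Build R V (submod_pred SP) SP.

Definition lquot := Quotient.quot (GRing.ZmodClosed.clone V (submod_pred SP) _).

HB.instance Definition _ := GRing.Zmodule.on lquot.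
HB.instance Definition _ := EqQuotient.on lquot.

Lemma lquotP (u v : V) : reflect (\pi_lquot u = \pi_lquot v) (u - v \in S).
Proof.
have e := Quotient.idealrBE (GRing.ZmodClosed.clone V (submod_pred SP) _) u v.
by apply: (iffP idP) => [h|/eqP h]; [apply/eqP; rewrite -e|rewrite -e in h].
Qed.

Lemma lquot_piD (u v : V) : \pi_lquot (u + v) = \pi_lquot u + \pi_lquot v.
Proof. exact: (Quotient.pi_add (GRing.ZmodClosed.clone V (submod_pred SP) _)). Qed.

Definition lquot_scale (a : R) (x : lquot) : lquot := \pi_lquot (a *: repr x).

Lemma lquot_piZ a (u : V) : \pi_lquot (a *: u) = lquot_scale a (\pi_lquot u).
Proof.
apply/lquotP; rewrite -scalerBr -[_ *: _]addr0; apply: SP.2; last exact: SP.1.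
by apply/lquotP; exact/esym/reprK.
Qed.

Fact lquot_scaleA a b x : lquot_scale a (lquot_scale b x) = lquot_scale (a * b) x.
Proof. by elim/quotW: x => x; rewrite -(lquot_piZ b x) -!lquot_piZ scalerA. Qed.

Fact lquot_scale1 : left_id 1 lquot_scale.
Proof. by elim/quotW=> x; rewrite -lquot_piZ scale1r. Qed.

Fact lquot_scaleDr : right_distributive lquot_scale +%R.
Proof.
move=> a; elim/quotW=> x; elim/quotW=> y.
by rewrite -lquot_piD -!lquot_piZ -lquot_piD scalerDr.
Qed.

Fact lquot_scaleDl x : {morph lquot_scale^~ x : a b / a + b}.
Proof.
by elim/quotW: x => x a b; rewrite -!lquot_piZ -lquot_piD scalerDl.
Qed.

HB.instance Definition _ := GRing.Zmodule_isLmodule.Build R lquot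
  lquot_scaleA lquot_scale1 lquot_scaleDr lquot_scaleDl.

Definition lquot_pi (u : V) : lquot := \pi_lquot u.

Fact lquot_pi_linear : linear lquot_pi.
Proof. by move=> a u v; rewrite /lquot_pi lquot_piD lquot_piZ. Qed.

HB.instance Definition _ :=
  GRing.isLinear.Build R V lquot _ lquot_pi lquot_pi_linear.

End Def.

Section Map.
Variables (V V' : lmodType R) (S : {pred V}) (S' : {pred V'}).
Variables (SP : submod_closed S) (SP' : submod_closed S').
Variables (phi : {linear V -> V'}) (phiS : forall u, u \in S -> phi u \in S').

Definition lquot_map & (forall u, u \in S -> phi u \in S') :
  lquot SP -> lquot SP' := fun x => lquot_pi SP' (phi (repr x)).

Lemma lquot_mapE u : lquot_map phiS (lquot_pi SP u) = lquot_pi SP' (phi u).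
Proof.
apply/lquotP; rewrite -linearB; apply: phiS; apply/lquotP; exact: reprK.
Qed.

Fact lquot_map_linear : linear (lquot_map phiS).
Proof.
move=> a; elim/quotW=> u; elim/quotW=> v.
rewrite -![\pi_(lquot _) _]/(lquot_pi SP _) -linearP !lquot_mapE.
by rewrite !linearP.
Qed.

HB.instance Definition _ :=
  GRing.isLinear.Build R (lquot SP) (lquot SP') _ (lquot_map phiS)
    lquot_map_linear.

End Map.

End QuotientModule.

Arguments lquot {R V S} SP.
Arguments lquot_pi {R V S} SP u.
Arguments lquot_map {R V V' S S'} SP SP' phi phiS x.

Section SmoothFunctions.
Variable R : realType.
Implicit Types M N : manifold R.

Definition smooth_fun M : {pred M -> R} := [pred h | `[< smooth_fun_set h >]].

Fact smooth_fun_submod_closed M : submod_closed (@smooth_fun M).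
Proof.
split=> [|a h h']; first by apply/asboolP => c _ k; exact: Ck_cst.
move=> /asboolP sh /asboolP sh'; apply/asboolP => c cA k.
have := @chart_img_open _ _ c => oc.
exact: (CkD oc (CkZ a oc (sh c cA k)) (sh' c cA k)).
Qed.

HB.instance Definition _ M :=
  GRing.isSubmodClosed.Build R (M -> R) (@smooth_fun M)
    (smooth_fun_submod_closed M).

Record Cinf M := MkCinf { Cinf_val :> M -> R; CinfP : Cinf_val \in @smooth_fun M }.

HB.instance Definition _ M := [isSub for @Cinf_val M].
HB.instance Definition _ M := [Choice of Cinf M by <:].
HB.instance Definition _ M := [SubChoice_isSubLmodule of Cinf M by <:].

Lemma in_charts_open M N (g : M -> N) (c : chart R M) (c' : chart R N) :
  continuous g ->
  open [set v | chart_img c v /\ chart_dom c' (g (chart_inv c v))].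
Proof.
move=> cg; rewrite openE => v [cv dv]; apply: filterI.
  exact: (open_nbhs_nbhs (conj (@chart_img_open _ _ c) cv)).
have ci : {for v, continuous (g \o chart_inv c)}.
  by apply: continuous_comp; [exact: chart_inv_cont|exact: cg].
exact: ci (open_nbhs_nbhs (conj (@chart_dom_open _ _ c') dv)).
Qed.

Lemma smooth_fun_comp M N (g : M -> N) (h : N -> R) :
  smooth_map g -> h \in @smooth_fun N -> h \o g \in @smooth_fun M.
Proof.
move=> [cg sg] /asboolP sh; apply/asboolP => c cA k.
apply: Ck_local => v cv.
have [c' cA' c'x] := atlas_cover (g (chart_inv c v)).
exists [set v | chart_img c v /\ chart_dom c' (g (chart_inv c v))] => //.
have oU := @in_charts_open _ _ _ c c' cg.
apply: (@Ck_ext _ _ _ _ _ ((h \o chart_inv c' : _ -> R^o) \o in_charts g c c')) => //.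
  by move=> u [_ du] /=; rewrite /in_charts/= chart_mapK.
apply: (@Ck_comp _ _ _ _ _ (chart_img c')) => //.
- by move=> u [_ du]; exact: chart_mapP.
- exact: sh.
- exact: sg.
Qed.

Definition Cinf_pullback M N (g : M -> N) (sg : smooth_map g) (h : Cinf N) : Cinf M :=
  MkCinf (smooth_fun_comp sg (CinfP h)).

Fact Cinf_pullback_linear M N (g : M -> N) (sg : smooth_map g) :
  linear (Cinf_pullback sg).
Proof. by move=> a h h'; exact/val_inj. Qed.

HB.instance Definition _ M N (g : M -> N) (sg : smooth_map g) :=
  GRing.isLinear.Build R (Cinf N) (Cinf M) _ (Cinf_pullback sg)
    (Cinf_pullback_linear sg).

End SmoothFunctions.

Record ord_map (m n : nat) := OrdMap {
  ord_fun :> 'I_m.+1 -> 'I_n.+1;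
  ord_fun_mono : forall i j : 'I_m.+1, (i <= j)%N -> (ord_fun i <= ord_fun j)%N
}.

Lemma ord_mapP m n (s t : ord_map m n) : s =1 t -> s = t.
Proof.
case: s t => [s sm] [t tm] /= /funext st; subst t.
by congr OrdMap; exact: Prop_irrelevance.
Qed.

Definition ord_id n : ord_map n n := @OrdMap n n id (fun _ _ => id).

Definition ord_comp l m n (s : ord_map m n) (t : ord_map l m) : ord_map l n :=
  @OrdMap l n (s \o t) (fun i j ij => ord_fun_mono s (ord_fun_mono t ij)).

Fact coface_mono n (i : 'I_n.+2) (j k : 'I_n.+1) :
  (j <= k)%N -> (lift i j <= lift i k)%N.
Proof. by rewrite /= leq_bump2. Qed.

Definition coface n (i : 'I_n.+2) : ord_map n n.+1 := OrdMap (@coface_mono n i).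

Record sset := SSet {
  simplex :> nat -> Type;
  sact : forall m n, ord_map m n -> simplex n -> simplex m;
  sact_id : forall n (x : simplex n), sact (ord_id n) x = x;
  sact_comp : forall l m n (s : ord_map m n) (t : ord_map l m) (x : simplex n),
    sact (ord_comp s t) x = sact t (sact s x)
}.

Record smap (K L : sset) := SMap {
  smap_fun :> forall n, K n -> L n;
  smap_nat : forall m n (s : ord_map m n) (x : K n),
    smap_fun (sact s x) = sact s (smap_fun x)
}.
Arguments smap_fun {K L} _ {n} _.

Fact Delta_id n m (t : ord_map m n) : ord_comp t (ord_id m) = t.
Proof. exact: ord_mapP. Qed.

Fact Delta_comp n k l m (s : ord_map l m) (t : ord_map k l) (u : ord_map m n) :
  ord_comp u (ord_comp s t) = ord_comp (ord_comp u s) t.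
Proof. exact: ord_mapP. Qed.

Definition Delta (n : nat) : sset :=
  @SSet (fun m => ord_map m n) (fun l m s t => ord_comp t s)
    (@Delta_id n) (@Delta_comp n).

Definition misses_vertex m n (t : ord_map m n) : Prop :=
  exists i, forall j, t j != i.

Record boundary_simplex (n m : nat) := BoundarySimplex {
  boundary_val :> ord_map m n;
  boundaryP : misses_vertex boundary_val
}.

Lemma boundary_val_inj n m : injective (@boundary_val n m).
Proof.
move=> [s sP] [t tP] /= st; subst t.
by congr BoundarySimplex; exact: Prop_irrelevance.
Qed.

Fact boundary_act_subproof n l m (s : ord_map l m) (t : boundary_simplex n m) :
  misses_vertex (ord_comp t s).
Proof. by case: t => t [i ti]; exists i => j; exact: ti. Qed.

Definition boundary_act n l m (s : ord_map l m) (t : boundary_simplex n m) :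
  boundary_simplex n l := BoundarySimplex (boundary_act_subproof s t).

Fact boundary_id n m (t : boundary_simplex n m) : boundary_act (ord_id m) t = t.
Proof. exact/boundary_val_inj/Delta_id. Qed.

Fact boundary_comp n k l m (s : ord_map l m) (t : ord_map k l)
    (u : boundary_simplex n m) :
  boundary_act (ord_comp s t) u = boundary_act t (boundary_act s u).
Proof. exact/boundary_val_inj/Delta_comp. Qed.

Definition boundary (n : nat) : sset :=
  @SSet (boundary_simplex n) (@boundary_act n) (@boundary_id n)
    (@boundary_comp n).

Definition boundary_incl (n : nat) : smap (boundary n) (Delta n) :=
  @SMap (boundary n) (Delta n) (@boundary_val n) (fun _ _ _ _ => erefl).

Definition smap_comp (J K L : sset) (g : smap K L) (h : smap J K) : smap J L :=
  @SMap J L (fun n x => g n (h n x))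
    (fun m n s x => etrans (congr1 (g m) (smap_nat h s x)) (smap_nat g s (h n x))).

Definition simplex_map (K : sset) (n : nat) (x : K n) : smap (Delta n) K :=
  @SMap (Delta n) K (fun m s => sact s x) (fun l m s t => sact_comp t s x).

(* [K] is generated by the simplices in [s] under the action of all monotone
   maps, degeneracies included. *)
Definition spans (K : sset) (s : seq {m & K m}) : Prop :=
  forall m (x : K m), exists2 a, List.In a s &
    exists t : ord_map m (tag a), x = sact t (tagged a).

Definition spans_rel (K L : sset) (i : smap K L)
    (s : seq {m & K m}) (t : seq {m & L m}) : Prop :=
  [/\ spans s,
      spans ([seq Tagged L (i _ (tagged a)) | a <- s] ++ t) &
      forall b, List.In b t -> forall x, i _ x <> tagged b].

Section SimplicialManifolds.
Variable R : realType.

Record smanifold := SManifold {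
  smobj :> nat -> manifold R;
  smact : forall m n, ord_map m n -> smobj n -> smobj m;
  smact_smooth : forall m n (s : ord_map m n), smooth_map (smact s);
  smact_id : forall n (x : smobj n), smact (ord_id n) x = x;
  smact_comp : forall l m n (s : ord_map m n) (t : ord_map l m) (x : smobj n),
    smact (ord_comp s t) x = smact t (smact s x)
}.

Definition sset_of (X : smanifold) : sset :=
  @SSet (fun n => X n) (@smact X) (@smact_id X) (@smact_comp X).

Record smooth_smap (X Y : smanifold) := SmoothSMap {
  smooth_smap_map :> smap (sset_of X) (sset_of Y);
  smooth_smapP : forall n, @smooth_map R (X n) (Y n) (smooth_smap_map n)
}.

Fixpoint span_space (X : smanifold) (K : sset) (s : seq {m & K m}) :
    manifold R :=
  if s is a :: s' then prod_manifold (X (tag a)) (span_space X s')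
  else point_manifold R.

Fixpoint span_eval (X : smanifold) (K : sset) (p : smap K (sset_of X))
    (s : seq {m & K m}) : span_space X s :=
  match s with
  | [::] => 0 : 'rV[R]_0
  | a :: s' => (p (tag a) (tagged a), span_eval p s')
  end.

Section Squares.
Variables (X Y : smanifold) (f : smooth_smap X Y).

(* Points of X^K x_{Y^K} Y^L. *)
Record squares (K L : sset) (i : smap K L) := Square {
  sq_left : smap K (sset_of X);
  sq_right : smap L (sset_of Y);
  sq_comm : forall n (x : K n), f n (sq_left n x) = sq_right n (i n x)
}.

Definition square_eval (K L : sset) (i : smap K L)
    (s : seq {m & K m}) (t : seq {m & L m}) (q : squares i) :
    prod_manifold (span_space X s) (span_space Y t) :=
  (span_eval (sq_left q) s, span_eval (sq_right q) t).

(* A manifold structure on X^K x_{Y^K} Y^L making it an embedded submanifold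
   of the product of the spaces of a finite spanning family.  It does not
   depend on that family, since evaluation at any other simplex factors
   smoothly through the given ones. *)
Record smooth_squares (K L : sset) (i : smap K L) := SmoothSquares {
  smooth_model :> manifold R;
  model_square : smooth_model -> squares i;
  model_square_bij : bijective model_square;
  model_square_embedding : exists s t, spans_rel i s t /\
    smooth_embedding (fun x => square_eval s t (model_square x))
}.

Fact boundary_square_comm n (x : X n) m (s : boundary n m) :
  f m (smap_comp (simplex_map (K := sset_of X) x) (boundary_incl n) m s) =
  simplex_map (K := sset_of Y) (f n x) m (boundary_incl n m s).
Proof. exact: smap_nat. Qed.

(* The Yoneda lemma identifies X_n with hom(Delta^n, X), and a map from
   Delta^n to Y with an element of Y_n. *)
Definition boundary_square n (x : X n) : squares (boundary_incl n) :=
  Square (boundary_square_comm x).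

Definition hypercover : Prop :=
  forall n, exists (M : smooth_squares (boundary_incl n)) (g : X n -> M),
    [/\ forall x, model_square (g x) = boundary_square x,
        forall y, exists x, g x = y &
        submersion g].

End Squares.

Section Cochains.
Variable X : smanifold.

Definition cochain_pull n (i : 'I_n.+2) : Cinf (X n) -> Cinf (X n.+1) :=
  Cinf_pullback (smact_smooth X (coface i)).

Definition delta n (h : Cinf (X n)) : Cinf (X n.+1) :=
  (-1) ^+ n.+1 *: \sum_(i < n.+2) (-1) ^+ i *: cochain_pull i h.

Fact delta_linear n : linear (@delta n).
Proof.
move=> a h h'; rewrite /delta scalerA mulrC -scalerA -scalerDr; congr (_ *: _).
rewrite scaler_sumr -big_split; apply: eq_bigr => i _.
by rewrite /cochain_pull linearP scalerDr !scalerA mulrC.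
Qed.

HB.instance Definition _ n :=
  GRing.isLinear.Build R _ _ _ (@delta n) (@delta_linear n).

Lemma deltaE n (h : Cinf (X n)) x :
  delta h x = (-1) ^+ n.+1 *
    \sum_(i < n.+2) (-1) ^+ i * h (smact (coface i) x).
Proof.
transitivity ((-1) ^+ n.+1 *
    \val (\sum_(i < n.+2) (-1) ^+ i *: cochain_pull i h) x); first by [].
by rewrite raddf_sum fct_sumE.
Qed.

Definition cocycle n : {pred Cinf (X n)} := [pred h | delta h == 0].

Fact cocycle_submod_closed n : submod_closed (@cocycle n).
Proof.
split=> [|a h h' /eqP dh /eqP dh']; apply/eqP; first exact: linear0.
by rewrite delta_linear dh dh' scaler0 addr0.
Qed.

HB.instance Definition _ n :=
  GRing.isSubmodClosed.Build R _ (@cocycle n) (@cocycle_submod_closed n).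

Record cocycles n := MkCocycle { cocycle_val :> Cinf (X n); cocycleP : cocycle_val \in @cocycle n }.

HB.instance Definition _ n := [isSub for @cocycle_val n].
HB.instance Definition _ n := [Choice of cocycles n by <:].
HB.instance Definition _ n := [SubChoice_isSubLmodule of cocycles n by <:].

(* In degree 0 the incoming differential is zero. *)
Definition coboundary n : set (Cinf (X n)) :=
  match n with
  | 0 => [set 0]
  | m.+1 => range (@delta m)
  end.

Definition exact_cocycle n : {pred cocycles n} := [pred z | `[< coboundary (val z) >]].

Fact exact_submod_closed n : submod_closed (@exact_cocycle n).
Proof.
split=> [|a z z' /asboolP bz /asboolP bz']; apply/asboolP.
  by case: n => [|n] //; exists 0 => //; exact: (linear0 (@delta n)).
have -> : val (a *: z + z') = a *: val z + val z' by [].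
case: n z z' bz bz' => [|n] z z' /=; first by move=> -> ->; rewrite scaler0 addr0.
by move=> [g _ <-] [g' _ <-]; exists (a *: g + g') => //; exact: delta_linear.
Qed.

End Cochains.
End SimplicialManifolds.

Section DeltaDelta.
Variables (R : realType) (X : smanifold R) (n : nat).

Lemma delta_delta (h : Cinf (X n)) : delta (delta h) = 0.
Proof.
apply: val_inj; apply/funext => x.
change (Cinf_val (delta (delta h)) x = 0); rewrite deltaE.
pose F (p : 'I_n.+3 * 'I_n.+2) : R := (-1) ^+ p.1 * ((-1) ^+ p.2 *
  h (smact (ord_comp (coface p.1) (coface p.2)) x)).
pose sg (p : 'I_n.+3 * 'I_n.+2) : 'I_n.+3 * 'I_n.+2 :=
  if (p.2 < p.1)%N then (inord p.2, inord p.1.-1)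
  else (inord p.2.+1, inord p.1).
have sg1 p : (sg p).1 = (if (p.2 < p.1)%N then p.2 : nat else p.2.+1) :> nat.
  by have b2 := ltn_ord p.2; rewrite /sg; case: ifP => h12 /=; rewrite inordK//; lia.
have sg2 p : (sg p).2 = (if (p.2 < p.1)%N then p.1.-1 else p.1) :> nat.
  have b2 := ltn_ord p.2; have b1 := ltn_ord p.1.
  by rewrite /sg; case: ifP => h12 /=; rewrite inordK//; lia.
have sgK : involutive sg.
  move=> p; rewrite [LHS]surjective_pairing [RHS]surjective_pairing.
  by congr pair; apply: val_inj; rewrite /= !(sg1, sg2);
     case: (ltnP p.2 p.1) => ?; case: ifP => ?; lia.
have Fsg p : F (sg p) = - F p.
  rewrite /F !mulrA -!exprD -mulNr; congr (_ * h (smact _ x)).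
    rewrite -[RHS]mulN1r -exprS -signr_odd -[in RHS]signr_odd; congr (_ ^+ _).
    by rewrite sg1 sg2; case: ifP => ?; congr nat_of_bool; lia.
  apply: ord_mapP => k; apply: val_inj; rewrite /= sg1 sg2 /bump.
  by case: (ltnP p.2 p.1) => ?; lia.
suff -> : \sum_(i < n.+3) (-1) ^+ i * delta h (smact (coface i) x) =
    (-1) ^+ n.+1 * \sum_p F p.
  have : \sum_p F p = - \sum_p F p.
    rewrite [LHS](reindex_inj (inv_inj sgK)) -sumrN.
    by apply: eq_bigr => p _; exact: Fsg.
  move=> S0; have -> : \sum_p F p = 0 by lra.
  by rewrite mulr0 mulr0.
have -> : \sum_p F p = \sum_i \sum_j F (i, j).
  by rewrite pair_bigA; apply: eq_bigr => -[].
rewrite mulr_sumr; apply: eq_bigr => i _; rewrite deltaE mulrCA; congr (_ * _).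
by rewrite mulr_sumr; apply: eq_bigr => j _; rewrite /F/= smact_comp.
Qed.

End DeltaDelta.

Section Cohomology.
Variable R : realType.

Definition cohomology (X : smanifold R) (n : nat) : lmodType R :=
  lquot (@exact_submod_closed R X n).

Variables (X Y : smanifold R) (f : smooth_smap X Y).

Definition cochain_map n : {linear Cinf (Y n) -> Cinf (X n)} :=
  Cinf_pullback (smooth_smapP f n).

Lemma cochain_map_delta n (h : Cinf (Y n)) :
  cochain_map n.+1 (delta h) = delta (cochain_map n h).
Proof.
apply: val_inj; apply/funext => x.
change (Cinf_val (delta h) (f n.+1 x) = Cinf_val (delta (cochain_map n h)) x).
rewrite !deltaE; congr (_ * _); apply: eq_bigr => i _; congr (_ * h _).
exact/esym/(smap_nat f).
Qed.

Fact cocycle_map_subproof n (z : cocycles Y n) :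
  cochain_map n (cocycle_val z) \in @cocycle R X n.
Proof.
apply/eqP; rewrite -cochain_map_delta (eqP (cocycleP z)); exact: linear0.
Qed.

Definition cocycle_map n (z : cocycles Y n) : cocycles X n :=
  MkCocycle (cocycle_map_subproof z).

Fact cocycle_map_linear n : linear (@cocycle_map n).
Proof. by move=> a z z'; apply: val_inj; rewrite /= linearP. Qed.

HB.instance Definition _ n :=
  GRing.isLinear.Build R _ _ _ (@cocycle_map n) (@cocycle_map_linear n).

Fact cocycle_map_coboundary n (z : cocycles Y n) :
  z \in @exact_cocycle R Y n -> cocycle_map z \in @exact_cocycle R X n.
Proof.
move=> /asboolP bz; apply/asboolP => /=.
case: n z bz => [|n] z /=; first by move=> ->; exact: linear0.
by move=> [g _ <-]; exists (cochain_map n g) => //; rewrite -cochain_map_delta.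
Qed.

Definition cohomology_map n : {linear cohomology Y n -> cohomology X n} :=
  lquot_map (@exact_submod_closed R Y n) (@exact_submod_closed R X n)
    (@cocycle_map n) (@cocycle_map_coboundary n).

Lemma cohomology_mapE n (z : cocycles Y n) :
  cohomology_map n (lquot_pi (@exact_submod_closed R Y n) z) =
  lquot_pi (@exact_submod_closed R X n) (cocycle_map z).
Proof. exact: lquot_mapE. Qed.

End Cohomology.

(* Main.v *)
Require Import Defs.
From HB Require Import structures.
From mathcomp Require Import all_boot all_order all_algebra perm.
From mathcomp Require Import all_classical all_reals.
From mathcomp Require Import interval_inference.
From mathcomp Require Import topology normedtype landau derive sequences realfun exp.
From mathcomp Require Import ring lra zify.

(* Every simplex [y] of [Y_m] is lifted to [X] at random: the faces of [y] are
   lifted one after the other, a face being lifted, once its boundary is, by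
   choosing among finitely many local sections of the submersion
   [X_k -> X^(boundary) x Y_k] with the weights of a partition of unity.  The
   choices on distinct faces are independent, so the restriction of a random
   lift of [y] to a face is a random lift of that face.  Averaging functions
   over random lifts is therefore a cochain map [Avg : C(X) -> C(Y)], and
   [Avg (f^* g) = g] because lifts lie over [y].  For the homotopy
   [f^* (Avg g) ~ g], lift the prism over [f x], with [x] prescribed on the
   bottom and everything else random.  The local sections come from
   the inverse function theorem. *)

Set Implicit Arguments.
Unset Strict Implicit.
Unset Printing Implicit Defensive.

Import Order.TTheory GRing.Theory Num.Theory.
Import numFieldNormedType.Exports.

Local Open Scope classical_set_scope.
Local Open Scope ring_scope.

(** * Smooth maps between normed spaces *)

(** Local sections of a submersion do not glue to a global one, and points of [X_k] cannot be
    averaged; functions can. A random lift is therefore known only through the functional that takes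
    a function of lifts to its expectation, built by [lift_all] as an iterated finite sum.
    Compatibility is obtained for injective maps only, since a random lift of a degenerate simplex
    need not be degenerate; [delta] involves faces alone, so this suffices. Partial lifts form no
    manifold, so smoothness is tested along maps from open sets of coordinate spaces. Such maps into
    a matching space are recognised simplex by simplex, because evaluation on a spanning family is
    an embedding. The prism is viewed inside a simplex, so that the procedure that lifts simplices
    lifts it too. *)

Section CkCalculus.
Variable R : realType.
Implicit Types V W : normedModType R.

Lemma Cinfty_open_local V W (U : set V) (f : V -> W) :
  (forall x, U x -> exists2 U', U' x & Cinfty U' f) -> Cinfty U f.
Proof. by move=> h k; apply: Ck_local => x /h[U' U'x Cf]; exists U'. Qed.

Lemma Ck_id V k (U : set V) : Ck k U (id : V -> V).
Proof.
case: k => [|k] /=; first by move=> x _; exact: cvg_id.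
split=> [x _|v]; first exact: ex_diff.
have -> : 'D_v (id : V -> V) = cst v by apply/funext => x; rewrite derive_id.
exact: Ck_cst.
Qed.

Lemma Ck_prod V k (U : set V) (I : Type) (s : seq I) (P : pred I)
    (f : I -> V -> R^o) :
  open U -> (forall i, Ck k U (f i)) ->
  Ck k U (fun x => \prod_(i <- s | P i) f i x : R^o).
Proof.
move=> oU h; elim: s => [|i s IHs].
  rewrite (_ : (fun _ => _) = cst 1); first exact: Ck_cst.
  by apply/funext => x; rewrite big_nil.
case Pi : (P i); last first.
  by rewrite (_ : (fun _ => _) = (fun x => \prod_(i <- s | P i) f i x : R^o))//;
     apply/funext => x; rewrite big_cons Pi.
rewrite (_ : (fun _ => _) = (f i : V -> R^o) *
    (fun x => \prod_(i <- s | P i) f i x : R^o) :> (V -> R^o)).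
  exact: CkM.
by apply/funext => x; rewrite big_cons Pi.
Qed.

Lemma Ck_bigsum V W k (U : set V) (I : Type) (s : seq I) (P : pred I)
    (f : I -> V -> W) :
  open U -> (forall i, Ck k U (f i)) ->
  Ck k U (fun x => \sum_(i <- s | P i) f i x).
Proof.
move=> oU h; elim: s => [|i s IHs].
  rewrite (_ : (fun _ => _) = cst 0); first exact: Ck_cst.
  by apply/funext => x; rewrite big_nil.
case Pi : (P i); last first.
  by rewrite (_ : (fun _ => _) = (fun x => \sum_(i <- s | P i) f i x))//;
     apply/funext => x; rewrite big_cons Pi.
rewrite (_ : (fun _ => _) = f i + (fun x => \sum_(i <- s | P i) f i x)).
  exact: CkD.
by apply/funext => x; rewrite big_cons Pi.
Qed.

Lemma Ck_inv V k (U : set V) (f : V -> R^o) :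
  open U -> (forall x, U x -> f x != 0) -> Ck k U f ->
  Ck k U (fun x => (f x)^-1 : R^o).
Proof.
move=> oU f0; elim: k => [|k IHk] Cf.
  by move=> x Ux; apply: cvgV; [exact: f0|exact: Cf].
have Cf' := CkW Cf; case: Cf => [df hf]; split=> [x Ux|v].
  by apply: differentiableV; [exact: df|exact: f0].
pose g : V -> R^o := fun x => (f x)^-1.
apply: (@Ck_ext _ _ _ _ _ ((-1) *: ((g * g : V -> R^o) * 'D_v f : V -> R^o))) => //.
  move=> x Ux; rewrite deriveV; [|exact: f0|exact/diff_derivable/df].
  by rewrite !fctE /= scaleN1r -mulNr -invfM -expr2.
apply: CkZ => //; apply: CkM => //; first by apply: CkM => //; exact: IHk.
exact: hf.
Qed.

Definition rV_coord n (j : 'I_n) (u : 'rV[R]_n) : R^o := u 0 j.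

Fact rV_coord_linear n (j : 'I_n) : linear (rV_coord j).
Proof. by move=> a u w; rewrite /rV_coord !mxE. Qed.

HB.instance Definition _ n (j : 'I_n) :=
  GRing.isLinear.Build R 'rV[R]_n R^o _ (rV_coord j) (rV_coord_linear j).

Lemma Ck_coord V n k (U : set V) (f : V -> 'rV[R]_n) (j : 'I_n) :
  open U -> Ck k U f -> Ck k U (fun x => f x 0 j : R^o).
Proof.
move=> oU Cf; apply: (Ck_linear_comp (L := rV_coord j)) => //.
exact: coord_continuous.
Qed.

Lemma Ck_rV V n k (U : set V) (f : V -> 'rV[R]_n) :
  open U -> (forall j, Ck k U (fun x => f x 0 j : R^o)) -> Ck k U f.
Proof.
move=> oU Cf.
rewrite (_ : f = \sum_(j < n) ( *:%R^~ (delta_mx 0 j) \o (fun x => f x 0 j : R^o))).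
  apply: Ck_sum => // j.
  have l : linear (fun a : R^o => a *: (delta_mx 0 j : 'rV[R]_n)).
    by move=> a b c; rewrite scalerDl -scalerA.
  pose L : {linear R^o -> 'rV[R]_n} := HB.pack (fun a : R^o => a *: (delta_mx 0 j : 'rV[R]_n))
    (GRing.isLinear.Build _ _ _ _ _ l).
  apply: (Ck_linear_comp (L := L)) => //; exact: scalel_continuous.
by apply/funext => x; rewrite fct_sumE [LHS]row_sum_delta.
Qed.

Lemma Ck_comp_rV V m n k (U : set V) (U' : set 'rV[R]_n)
    (f : 'rV[R]_n -> 'rV[R]_m) (g : V -> 'rV[R]_n) :
  open U -> open U' -> (forall x, U x -> U' (g x)) -> Ck k U' f -> Ck k U g ->
  Ck k U (f \o g).
Proof.
move=> oU oU' gU Cf Cg; apply: Ck_rV => // j.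
exact: (@Ck_comp _ _ _ _ _ _ (fun x => f x 0 j : R^o) g oU gU (Ck_coord j oU' Cf) Cg).
Qed.

Lemma Ck_mulmxr V m n k (U : set V) (f : V -> 'rV[R]_m) (B : 'M[R]_(m, n)) :
  open U -> Ck k U f -> Ck k U (fun x => f x *m B).
Proof.
move=> oU Cf; apply: Ck_rV => // j.
rewrite (_ : (fun _ => _) = (fun x => \sum_i (B i j *: (fun x => f x 0 i : R^o)) x)).
  by apply: Ck_bigsum => // i; apply: CkZ => //; exact: Ck_coord.
by apply/funext => x; rewrite mxE; apply: eq_bigr => i _; rewrite mulrC.
Qed.

Lemma CkB V W k (U : set V) (f g : V -> W) :
  open U -> Ck k U f -> Ck k U g -> Ck k U (f - g).
Proof.
move=> oU Cf Cg; rewrite -(scaleN1r g); apply: CkD => //; exact: CkZ.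
Qed.

Lemma Ck_det V n k (U : set V) (A : V -> 'M[R]_n) :
  open U -> (forall i j, Ck k U (fun x => A x i j : R^o)) ->
  Ck k U (fun x => \det (A x) : R^o).
Proof.
move=> oU CA; apply: Ck_bigsum => // s.
rewrite (_ : (fun _ => _) = (-1) ^+ s *: (fun x => \prod_i A x i (s i) : R^o)) //.
by apply: CkZ => //; exact: Ck_prod.
Qed.

Lemma Ck_invmx V n k (U : set V) (A : V -> 'M[R]_n) :
  open U -> (forall x, U x -> A x \in unitmx) ->
  (forall i j, Ck k U (fun x => A x i j : R^o)) ->
  forall i j, Ck k U (fun x => invmx (A x) i j : R^o).
Proof.
move=> oU uA CA i j.
apply: (@Ck_ext _ _ _ _ _ ((fun x => (\det (A x))^-1 : R^o) *
    ((-1) ^+ (j + i) *: (fun x => \det (row' j (col' i (A x))) : R^o)) : V -> R^o)) => //.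
  by move=> x Ux; rewrite /invmx (uA _ Ux) !mxE.
apply: CkM => //.
  by apply: Ck_inv => // [x /uA|]; [rewrite unitmxE unitfE|exact: Ck_det].
apply: CkZ => //; apply: Ck_det => // a b.
rewrite (_ : (fun _ => _) = (fun x => A x (lift j a) (lift i b) : R^o)) //.
by apply/funext => x; rewrite !mxE.
Qed.

End CkCalculus.

(** * Flat functions *)

Section FlatFunctions.
Variable R : realType.

(** The polynomial factor makes the family stable under differentiation: with [s = 1/t],
    [d/dt = - s^2 d/ds] sends [q(s) e^(-s)] to [s^2 (q - q')(s) e^(-s)]. The bumps use [q = 1]. *)
Definition flat (q : {poly R}) (t : R) : R^o :=
  if 0 < t then q.[t^-1] * expR (- t^-1) else 0.

Lemma flat_gt0 t : 0 < t -> 0 < flat 1 t.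
Proof. by move=> t0; rewrite /flat t0 hornerC mul1r expR_gt0. Qed.

Lemma flat_le0 q t : t <= 0 -> flat q t = 0.
Proof. by move=> t0; rewrite /flat ltNge t0. Qed.

Lemma flat_ge0 t : 0 <= flat 1 t.
Proof. by have [/flat_gt0/ltW|/flat_le0->] := ltP 0 t. Qed.

(** Any bound [o(t)] makes the derivative at [0] vanish; the quadratic one comes from
    [e^s >= s^(i+2) / (i+2)!] at [s = 1/t], applied to each monomial of [q]. *)
Lemma flat_bound q : exists C, forall t, `|flat q t| <= C * t ^+ 2.
Proof.
exists (\sum_(i < size q) `|q`_i| * i.+2`!%:R) => t.
have [t0|t0] := ltP 0 t; last first.
  by rewrite flat_le0// normr0 mulr_ge0 ?sqr_ge0// sumr_ge0// => i _; rewrite mulr_ge0.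
rewrite /flat t0 horner_coef normrM (gtr0_norm (expR_gt0 _)).
have pow i : t^-1 ^+ i * expR (- t^-1) <= i.+2`!%:R * t ^+ 2.
  have ti0 : 0 < t^-1 by rewrite invr_gt0.
  have := expR_ge1Dxn i.+1 (ltW ti0).
  have f0 : (0 : R) < i.+2`!%:R by rewrite ltr0n fact_gt0.
  rewrite expRN => h; rewrite ler_pdivrMr ?expR_gt0//.
  have {h} : t^-1 ^+ i.+2 / i.+2`!%:R <= expR t^-1 by lra.
  rewrite ler_pdivrMr// => h.
  have -> : t^-1 ^+ i = t^-1 ^+ i.+2 * t ^+ 2.
    by rewrite -addn2 exprD -mulrA -exprMn mulVf ?gt_eqF// expr1n mulr1.
  rewrite [leRHS]mulrAC; apply: ler_wpM2r; first exact: sqr_ge0.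
  by rewrite mulrC.
rewrite mulr_suml.
apply: le_trans (ler_wpM2r (expR_ge0 _) (ler_norm_sum _ _ _)) _.
rewrite mulr_suml; apply: ler_sum => i _; rewrite normrM -!mulrA.
apply: ler_wpM2l => //; rewrite normrX gtr0_norm ?invr_gt0//; exact: pow.
Qed.

Lemma is_derive_flat q t :
  is_derive t (1 : R^o) (flat q : R^o -> R^o) (flat ('X^2 * (q - q^`())) t).
Proof.
have [t0|t0|t0] := ltrgtP 0 t.
- apply: (@near_eq_is_derive R R^o R^o (fun t => q.[t^-1] * expR (- t^-1))).
    near=> s; rewrite /flat; suff -> : 0 < s by [].
    by near: s; apply: lt_nbhsr.
  have tn0 : t != 0 by rewrite gt_eqF.
  have dinv : is_derive t (1:R) (fun s : R => s^-1) (- t ^- 2).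
    apply: DeriveDef; first by apply: derivableV.
    by rewrite deriveV// derive_id [LHS]mulr1.
  have d1 := is_derive1_comp (is_derive_poly q t^-1) dinv.
  have d2 := is_deriveN dinv.
  have d3 := @is_derive1_comp _ expR (fun s => - s^-1) t _ _ (is_derive_expR (- t^-1)) d2.
  have := is_deriveM d1 d3; rewrite /= => d.
  suff -> : flat ('X^2 * (q - q^`())) t = q.[t^-1] *: (expR (- t^-1) * - - t ^- 2) +
       expR (- t^-1) *: (q^`().[t^-1] * - t ^- 2) by exact: d.
  rewrite /flat t0 !hornerE /= /GRing.scale /=; field.
  exact: tn0.
- apply: (@near_eq_is_derive R R^o R^o (cst 0)).
    near=> s; rewrite flat_le0//; apply/ltW; near: s; exact: lt_nbhsl.
  by rewrite flat_le0 ?ltW//; exact: is_derive_cst.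
- rewrite -t0 flat_le0//.
  have [C hC] := flat_bound q.
  have C1 : 0 < `|C| + 1 by rewrite ltr_wpDl.
  have cv : h^-1 *: (flat q (h *: (1 : R^o) + 0) - flat q 0) @[h --> (0:R^o)^'] --> (0 : R^o).
    apply/cvgr0Pnorm_le => e e0; near=> h.
    have h0 : h != 0 by near: h; exact: nbhs_dnbhs_neq.
    rewrite addr0 [h *: 1]mulr1 (flat_le0 _ (lexx 0)) subr0 normrM normfV.
    rewrite ler_pdivrMl ?normr_gt0//; apply: le_trans (hC h) _.
    have he : `|h| <= e / (`|C| + 1).
      near: h; apply: nbhs_dnbhs; apply/nbhs_normP; exists (e / (`|C| + 1)) => /=.
        exact: divr_gt0.
      by move=> z /=; rewrite sub0r normrN => /ltW.
    rewrite -(real_normK (num_real h)) expr2 mulrCA; apply: ler_wpM2l => //.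
    move: he; rewrite ler_pdivlMr//; apply: le_trans; rewrite mulrC.
    apply: ler_wpM2l => //; apply: le_trans (ler_norm _) _.
    by rewrite lerDl.
  apply: DeriveDef; last exact: cvg_lim cv.
  by apply/cvg_ex; exists 0.
Unshelve. all: by end_near. Qed.

Lemma Ck_flat (V : normedModType R) k (U : set V) (u : V -> R^o) q :
  open U -> Ck k U u -> Ck k U (flat q \o u).
Proof.
have df p t : differentiable (flat p : R^o -> R^o) t.
  apply/derivable1_diffP; exact: (@ex_derive _ _ _ _ _ _ _ (is_derive_flat p t)).
move=> oU; elim: k q => [|k IHk] q Cu.
  move=> x Ux; apply: continuous_comp; first exact: Cu.
  exact/differentiable_continuous/df.
have Cu' := CkW Cu; case: Cu => [du hu]; split=> [x Ux|v].
  by apply: differentiable_comp; [exact: du|exact: df].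
apply: (@Ck_ext _ _ _ _ _
  ((flat ('X^2 * (q - q^`())) \o u : V -> R^o) * 'D_v u : V -> R^o)) => //.
  move=> x Ux; rewrite [RHS]deriveE; last first.
    by apply: differentiable_comp; [exact: du|exact: df].
  rewrite diff_comp; [|exact: du|exact: df].
  rewrite /= -(deriveE _ (du _ Ux)) diff1E; last exact: df.
  rewrite derive1E (@derive_val _ _ _ _ _ _ _ (is_derive_flat q (u x))).
  by rewrite /GRing.scale /= mulrC.
by apply: CkM => //; [exact: IHk|exact: hu].
Qed.

(** A smooth step: [1] where [v <= 0], [0] where [u <= 0], with a positive denominator because at
    each point [u] or [v] is positive. *)
Lemma Ck_flat_quot (V : normedModType R) k (U : set V) (u v : V -> R^o) :
  open U -> (forall x, U x -> 0 < u x \/ 0 < v x) -> Ck k U u -> Ck k U v ->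
  Ck k U (fun x => flat 1 (u x) / (flat 1 (u x) + flat 1 (v x)) : R^o).
Proof.
move=> oU uv Cu Cv; have Cfu := Ck_flat 1 oU Cu; have Cfv := Ck_flat 1 oU Cv.
apply: (CkM (f := flat 1 \o u) (g := fun x => (flat 1 (u x) + flat 1 (v x))^-1)) => //.
apply: Ck_inv => //; last exact: (CkD oU Cfu Cfv).
move=> x /uv h; rewrite gt_eqF//; case: h => /flat_gt0 h.
  by apply: ltr_pwDl => //; exact: flat_ge0.
by apply: ltr_wpDl => //; exact: flat_ge0.
Qed.

End FlatFunctions.

(** * The inverse function theorem *)

Section InverseFunction.
Variable R : realType.

HB.instance Definition _ n := Complete.on 'rV[R]_n.

Lemma coord_norm_le n (x : 'rV[R]_n) j : `|x 0 j| <= `|x|.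
Proof.
rewrite [leRHS]/Num.norm /= mx_normrE; apply/bigmax_geP; right => /=.
by exists (0, j).
Qed.

Lemma rV_norm_le n (x : 'rV[R]_n) c :
  0 <= c -> (forall j, `|x 0 j| <= c) -> `|x| <= c.
Proof.
move=> c0 h; rewrite /Num.norm /= mx_normrE; apply/bigmax_leP; split=> //=.
by move=> [i j] _ /=; rewrite (ord1 i).
Qed.

(** The norm is the sup norm, so the scalar mean value theorem along the segment, one coordinate at
    a time, loses no constant. *)
Lemma mean_value_le n m (f : 'rV[R]_n -> 'rV[R]_m) (S : set 'rV[R]_n) c u w :
  0 <= c -> (forall t : R, 0 <= t <= 1 -> S (w + t *: (u - w))) ->
  (forall x, S x -> differentiable f x) ->
  (forall x v, S x -> `|'d f x v| <= c * `|v|) ->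
  `|f u - f w| <= c * `|u - w|.
Proof.
move=> c0 hS df dfc; apply: rV_norm_le => [|j]; first by rewrite mulr_ge0.
pose d := u - w.
pose L (t : R) : 'rV[R]_n := w + t *: d.
have dL (t : R) : is_diff t (L : R -> 'rV[R]_n) ( *:%R^~ d).
  have := is_diffD (is_diff_cst w t) (is_diff_scalel t d).
  by rewrite add0r.
pose g (t : R) : R := rV_coord j (f (L t)).
have dg (t : R) : 0 <= t <= 1 -> is_derive t 1 g (rV_coord j ('d f (L t) d)).
  move=> t01; have St := hS t t01.
  have h1 : differentiable (f \o L) t.
    by apply: differentiable_comp; [exact: ex_diff|exact: df].
  have lc : differentiable (@rV_coord R m j) (f (L t)).
    by apply: linear_differentiable; exact: coord_continuous.
  apply: DeriveDef; first by apply/diff_derivable/differentiable_comp.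
  rewrite deriveE; last exact: differentiable_comp.
  rewrite (diff_comp h1 lc) /= diff_lin; last exact: coord_continuous.
  rewrite diff_comp; [|exact: ex_diff|exact: df].
  by rewrite /= (diff_val (is_diff_def := dL t)) scale1r.
have [//|||t t01 e] := @MVT_segment R g (fun t => rV_coord j ('d f (L t) d)) 0 1.
- by move=> t; rewrite in_itv /= => /andP[/ltW t0 /ltW t1]; apply: dg; rewrite t0.
- apply: derivable_within_continuous => t; rewrite in_itv /= => t01.
  exact: (@ex_derive _ _ _ _ _ _ _ (dg t t01)).
have -> : (f u - f w) 0 j = g 1 - g 0.
  have L0 : L 0 = w by rewrite /L scale0r addr0.
  have L1 : L 1 = u by rewrite /L scale1r addrC subrK.
  by rewrite /g L0 L1 /rV_coord 2!mxE.
rewrite e subr0 mulr1; apply: le_trans (coord_norm_le _ _) _.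
by apply: dfc; apply: hS; move: t01; rewrite in_itv.
Qed.

End InverseFunction.

Section InverseFunction.
Variable R : realType.

Section Local.
Variables (n : nat) (phi : 'rV[R]_n -> 'rV[R]_n) (a : 'rV[R]_n).

Lemma near_identity (U : set 'rV[R]_n) : open U -> U a -> Ck 1 U phi ->
  (forall v, 'd phi a v = v) ->
  exists2 r, 0 < r & forall u, `|u - a| <= r ->
    U u /\ forall v, `|v - 'd phi u v| <= 2^-1 * `|v|.
Proof.
move=> oU Ua [df Df] da.
(* An error [e] in each of the [n] partial derivatives adds up to at most [n e <= 1/2]; [n.+1] keeps
   [e] positive when [n = 0]. *)
pose e : R := (2 * n.+1%:R)^-1.
have e0 : 0 < e by rewrite invr_gt0 mulr_gt0.
have nr : \forall u \near a, U u /\ forall j, `|delta_mx 0 j - 'D_(delta_mx 0 j) phi u| <= e.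
  near=> u; split.
    by near: u; exact: open_nbhs_nbhs.
  near: u; apply: filter_forall => j.
  have /cvgrPdist_le/(_ e e0) := Df (delta_mx 0 j) a Ua.
  by rewrite deriveE ?da//; exact: df.
have /nbhs_normP[r /= r0 hr] := nr.
exists (r / 2) => [|u ur]; first by rewrite divr_gt0.
have /hr[Uu he] : ball_ Num.norm a r u.
  by rewrite /= distrC (le_lt_trans ur)// ltr_pdivrMr// ltr_pMr// ltr1n.
split=> // v; rewrite [in leLHS](row_sum_delta v) linear_sum -sumrB.
apply: le_trans (ler_norm_sum _ _ _) _.
apply: le_trans (_ : \sum_(j < n) `|v| * e <= _).
  apply: ler_sum => j _; rewrite linearZ /= -scalerBr normrZ.
  apply: ler_pM => //; first exact: coord_norm_le.
  by rewrite -deriveE; [exact: he|exact: df].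
rewrite sumr_const card_ord -[_ *+ n]mulr_natr -mulrA mulrC; apply: ler_wpM2r => //.
rewrite /e invfM -mulrA; apply: ler_piMr => //.
by rewrite ler_pdivrMl// mulr1 ler_nat.
Unshelve. all: by end_near. Qed.

Variables (U : set 'rV[R]_n) (r : R).
Hypotheses (r0 : 0 < r) (df : forall u, U u -> differentiable phi u).
Hypothesis phir : forall u, `|u - a| <= r ->
  U u /\ forall v, `|v - 'd phi u v| <= 2^-1 * `|v|.

Lemma near_identity_lip u w : `|u - a| <= r -> `|w - a| <= r ->
  `|(u - phi u) - (w - phi w)| <= 2^-1 * `|u - w|.
Proof.
move=> ur wr.
have df' x : `|x - a| <= r -> is_diff x (fun x => x - phi x) (fun v => v - 'd phi x v).
  by move=> /phir[/df dx _]; exact: (is_diffB (is_diff_id x) (differentiableP dx)).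
apply: (@mean_value_le _ _ _ (fun x => x - phi x) [set u | `|u - a| <= r]) => //=.
- move=> t /andP[t0 t1].
  have -> : w + t *: (u - w) - a = (1 - t) *: (w - a) + t *: (u - a).
    rewrite !scalerBr scalerBl scale1r.
    by apply/rowP => i; rewrite !mxE; ring.
  apply: le_trans (ler_normD _ _) _; rewrite !normrZ !ger0_norm ?subr_ge0//.
  have : (1 - t) * `|w - a| <= (1 - t) * r by apply: ler_wpM2l => //; rewrite subr_ge0.
  have : t * `|u - a| <= t * r by apply: ler_wpM2l.
  lra.
- by move=> x xr; exact: (@ex_diff _ _ _ _ _ _ _ (df' x xr)).
- move=> x v xr; rewrite (@diff_val _ _ _ _ _ _ _ (df' x xr)).
  by have [_] := phir xr.
Qed.

Lemma near_identity_expand u w : `|u - a| <= r -> `|w - a| <= r ->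
  `|u - w| <= 2 * `|phi u - phi w|.
Proof.
move=> ur wr; have := near_identity_lip ur wr.
have : `|u - w| <= `|phi u - phi w| + `|(u - phi u) - (w - phi w)|.
  apply: le_trans (ler_normD _ _); rewrite le_eqVlt; apply/orP; left; apply/eqP.
  by congr Num.norm; apply/rowP => i; rewrite !mxE; ring.
lra.
Qed.

Lemma near_identity_surj w : `|w - phi a| < r / 2 ->
  exists2 u, `|u - a| < r & phi u = w.
Proof.
move=> wr.
pose S := [set u | `|u - a| <= r].
(* Fixed points of [T] solve [phi u = w]. As [id - phi] is [1/2]-Lipschitz, [T u] stays within
   [r/2 + |w - phi a| < r] of [a]. *)
pose T u := u - phi u + w.
have aa : `|a - a| <= r by rewrite subrr normr0 ltW.
have TS u : S u -> S (T u).
  move=> Su; rewrite /S /T /=.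
  have -> : u - phi u + w - a = (u - phi u) - (a - phi a) + (w - phi a).
    by apply/rowP => i; rewrite !mxE; ring.
  apply: le_trans (ler_normD _ _) _.
  have := near_identity_lip Su aa; move: Su; rewrite /S/=; lra.
pose Tf : {fun S >-> S} := HB.pack T (isFun.Build _ _ S S T TS).
have cT : is_contraction Tf.
  exists (2^-1)%:nng; split; first by rewrite /= invf_lt1// ltr1n.
  move=> [x y] [/= Sx Sy]; rewrite /T opprD addrACA subrr addr0.
  exact: near_identity_lip.
have [||u Su uT] := banach_fixed_point cT.
- rewrite (_ : S = closed_ball_ Num.norm a r); first exact: closed_closed_ball_.
  by apply/seteqP; split=> u /=; rewrite /S /closed_ball_ /= distrC.
- by exists a.
have phiu : phi u = w.
  move: uT; rewrite /= /T => /eqP; rewrite -subr_eq0.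
  rewrite opprD opprB addrA addrCA subrr addr0 subr_eq0 => /eqP; exact.
(* The expansion bound sharpens [|u - a| <= r] to [|u - a| <= 2 |w - phi a| < r]. *)
exists u => //; have := near_identity_expand Su aa; rewrite phiu; lra.
Qed.

End Local.
End InverseFunction.

Section InverseFunctionTheorem.
Variable R : realType.

(** With [k = s (w + h) - s w], differentiability of [phi] reads [k A - h = o(k)]; the Lipschitz
    bound on [s] turns [o(k)] into [o(h)], and multiplying by the inverse of [A] isolates [k]. *)
Lemma is_diff_inverse n (phi s : 'rV[R]_n -> 'rV[R]_n) (W : set 'rV[R]_n) w :
  open W -> W w -> (forall z, W z -> phi (s z) = z) ->
  (forall z, W z -> `|s z - s w| <= 2 * `|z - w|) ->
  differentiable phi (s w) -> jacobian phi (s w) \in unitmx ->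
  is_diff w s (mulmxr (invmx (jacobian phi (s w)))).
Proof.
move=> oW Ww phis ls df uA; set A := jacobian phi (s w) in uA *; set B := invmx A.
have dA v : 'd phi (s w) v = v *m A by rewrite -deriveE// deriveEjacobian.
have cB : continuous (mulmxr B : 'rV[R]_n -> 'rV[R]_n).
  move=> x; have C0 : Ck 0 setT (fun x : 'rV[R]_n => x *m B).
    by apply: Ck_mulmxr; [exact: openT|exact: Ck_id].
  exact: C0.
have [C C0 hC] := linear_lipschitz cB.
have hd : continuous (mulmxr B : 'rV[R]_n -> 'rV[R]_n) /\
    s \o shift w = cst (s w) + mulmxr B +o_ (0 : 'rV[R]_n) id.
  split=> //; apply/eqaddoP => e e0.
  (* [C] is a Lipschitz constant of [B] and [2] one of [s] at [w], so the final error is [e |h|]. *)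
  have e'0 : 0 < e / (2 * C) by rewrite divr_gt0// mulr_gt0.
  have /eqaddoP/(_ _ e'0)/nbhs_normP[d /= d0 hd] := diff_locally df.
  have nh : \forall h \near (0 : 'rV[R]_n), `|h| < 2^-1 * d.
    by apply: nbhs0_lt; rewrite mulr_gt0.
  near=> h.
  have Whw : W (h + w).
    near: h; have : \forall z \near w, W z by exact: open_nbhs_nbhs.
    by rewrite (near_shift 0 w) subr0.
  set k := s (h + w) - s w.
  have hk : `|k| <= 2 * `|h| by have := ls _ Whw; rewrite addrK.
  have kd : `|k| < d.
    apply: le_lt_trans hk _; rewrite -ltr_pdivlMl//; near: h.
    exact: nh.
  have := hd k; rewrite /= sub0r normrN => /(_ kd).
  rewrite !fctE /= subrK phis// phis// dA => hk2.
  have -> : s (h + w) - (s w + h *m B) = mulmxr B (k *m A - h).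
    rewrite /= mulmxBl mulmxK// /k.
    by apply/rowP => i; rewrite !mxE; ring.
  apply: le_trans (hC _) _.
  have {}hk2 : `|k *m A - h| <= e / (2 * C) * `|k|.
    move: hk2; rewrite opprD addrA addrK -normrN opprB; exact.
  apply: le_trans (_ : C * (e / (2 * C) * (2 * `|h|)) <= _).
    apply: ler_wpM2l; first exact: ltW.
    by apply: le_trans hk2 _; apply: ler_wpM2l => //; exact: ltW.
  rewrite le_eqVlt; apply/orP; left; apply/eqP; field; by rewrite gt_eqF.
have ds : 'd s w = mulmxr B :> ('rV[R]_n -> 'rV[R]_n).
  by rewrite (diff_unique hd.1 hd.2).
by apply: DiffDef => //; apply/diff_locallyP; rewrite ds.
Unshelve. all: by end_near. Qed.

(** The derivative at [a] is normalised to the identity: immersions reach this form by a linear map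
    after their chart expression, submersions by an affine slice before it. *)
Theorem inverse_function n (U : set 'rV[R]_n) (phi : 'rV[R]_n -> 'rV[R]_n) a :
  open U -> U a -> Cinfty U phi -> (forall v, 'd phi a v = v) ->
  exists U' W : set 'rV[R]_n, exists s : 'rV[R]_n -> 'rV[R]_n,
    [/\ open U', U' a, U' `<=` U, open W & W (phi a)] /\
    [/\ Cinfty W s, forall w, W w -> U' (s w) /\ phi (s w) = w &
        forall u, U' u -> W (phi u) /\ s (phi u) = u].
Proof.
move=> oU Ua Cphi da.
have [r r0 hr] := near_identity oU Ua (Cphi 1) da.
have df u : U u -> differentiable phi u := (Cphi 1).1 u.
pose W := [set w | `|w - phi a| < r / 2].
pose Ur := [set u | `|u - a| < r].
have oball (b : 'rV[R]_n) d : open [set w | `|w - b| < d].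
  rewrite -/((fun w => `|w - b|) @^-1` [set x | x < d]).
  apply: open_comp; last exact: open_lt.
  move=> x _; apply: (@continuous_comp _ _ _ (fun w => w - b) Num.norm).
    by apply: continuousB; [exact: cvg_id|exact: cst_continuous].
  exact: norm_continuous.
have rW : (r / 2) < r by rewrite ltr_pdivrMr// ltr_pMr// ltr1n.
have UrU : Ur `<=` U by move=> u /ltW /hr[].
have /choice[s hs] : forall w, exists u, W w -> `|u - a| < r /\ phi u = w.
  move=> w; have [Ww|nW] := pselect (W w); last by exists a.
  by have [u ? ?] := near_identity_surj r0 df hr Ww; exists u.
have sl w z : W w -> W z -> `|s w - s z| <= 2 * `|w - z|.
  move=> Ww Wz; have [/ltW sw e] := hs w Ww; have [/ltW sz e'] := hs z Wz.
  by have := near_identity_expand df hr sw sz; rewrite e e'.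
(* A vector [v] killed by the derivative satisfies [|v| <= |v| / 2]. *)
have uA u : Ur u -> jacobian phi u \in unitmx.
  move=> ur; have [Uu hu] := hr u (ltW ur).
  rewrite -row_free_unit -kermx_eq0; apply/eqP/row_matrixP => i; rewrite row0.
  set v := row i _.
  have v0 : v *m jacobian phi u = 0 by rewrite /v -row_mul mulmx_ker row0.
  have := hu v; rewrite -deriveE ?deriveEjacobian ?v0 ?subr0; [|exact: df..].
  move=> vv; apply/eqP; rewrite -normr_eq0 eq_le normr_ge0 andbT.
  by have := normr_ge0 v; lra.
have Ws w : W w -> Ur (s w) by move=> /hs[].
have ds w : W w -> is_diff w s (mulmxr (invmx (jacobian phi (s w)))).
  move=> Ww; apply: (@is_diff_inverse _ _ _ W) => //.
  - exact: oball.
  - by move=> z /hs[].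
  - by move=> z Wz; exact: sl.
  - exact/df/UrU/Ws.
  - exact/uA/Ws.
(* Bootstrapping: the derivative of [s] is the inverse Jacobian of [phi] composed with [s], hence is
   [C^k] as soon as [s] is. *)
have Cs k : Ck k W s.
  elim: k => [w Ww|k IHk].
    exact/differentiable_continuous/(@ex_diff _ _ _ _ _ _ _ (ds w Ww)).
  split=> [w Ww|v]; first exact: (@ex_diff _ _ _ _ _ _ _ (ds w Ww)).
  pose G u := v *m invmx (jacobian phi u).
  apply: (@Ck_ext _ _ _ _ _ (G \o s)); first exact: oball.
    move=> w Ww; rewrite deriveE; last exact: (@ex_diff _ _ _ _ _ _ _ (ds w Ww)).
    by rewrite (@diff_val _ _ _ _ _ _ _ (ds w Ww)).
  apply: (@Ck_comp_rV _ _ _ _ _ _ Ur) => //; [exact: oball..|].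
  apply: Ck_rV => [|j]; first exact: oball.
  rewrite (_ : (fun _ => _) = (fun u => \sum_i
      (v 0 i *: (fun u => invmx (jacobian phi u) i j : R^o)) u)); last first.
    by apply/funext => u; rewrite /G mxE; apply: eq_bigr.
  apply: Ck_bigsum => [|i]; first exact: oball.
  apply: CkZ; first exact: oball.
  apply: Ck_invmx => // [|l m]; first exact: oball.
  apply: (@Ck_ext _ _ _ _ _ (fun u => ('D_(delta_mx 0 l) phi u) 0 m : R^o)).
  - exact: oball.
  - by move=> u /UrU/df dfu; rewrite mxE deriveE.
  - apply: Ck_coord; first exact: oball.
    by apply: Ck_subset UrU _; exact: (Cphi k.+1).2.
have nWphi u : Ur u -> W (phi u) -> s (phi u) = u.
  move=> Uu Wu; have [/ltW su e] := hs _ Wu.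
  have := near_identity_expand df hr su (ltW Uu); rewrite e subrr normr0 mulr0.
  by rewrite normr_le0 subr_eq0 => /eqP.
(* Cutting down to the preimage of [W] makes [phi] and [s] mutually inverse. *)
exists (Ur `&` phi @^-1` W), W, s; split; split.
- rewrite openE => u [Uu Wu]; apply: filterI.
    by apply: open_nbhs_nbhs; split=> //; exact: oball.
  have /differentiable_continuous cu := df u (UrU _ Uu).
  by apply: cu; apply: open_nbhs_nbhs; split=> //; exact: oball.
- by split; rewrite /Ur /W /= subrr normr0 ?divr_gt0.
- by move=> u [/UrU].
- exact: oball.
- by rewrite /W /= subrr normr0 divr_gt0.
- exact: Cs.
- by move=> w Ww; have [? e] := hs w Ww; split=> //; split=> //; rewrite /= e.
- by move=> u [Uu Wu]; split=> //; exact: nWphi.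
Qed.

End InverseFunctionTheorem.

(** * Smooth maps from open sets of coordinate spaces to manifolds *)

Section Plots.
Variable R : realType.
Implicit Types M N : manifold R.

(** A plot of [M] in the sense of diffeology. Families of squares or of partial lifts can be tested
    this way on each simplex, without an atlas for them. *)
Definition smooth_on d (U : set 'rV[R]_d) M (p : 'rV[R]_d -> M) : Prop :=
  (forall u, U u -> {for u, continuous p}) /\
  forall c, atlas c -> Cinfty (U `&` p @^-1` chart_dom c) (chart_map c \o p).

Lemma open_preimage_in (T T' : topologicalType) (U : set T) (A : set T') (p : T -> T') :
  open U -> open A -> (forall u, U u -> {for u, continuous p}) ->
  open (U `&` p @^-1` A).
Proof.
move=> oU oA cp; rewrite openE => u [Uu pu]; apply: filterI.
  exact: open_nbhs_nbhs.
by apply: cp => //; exact: open_nbhs_nbhs.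
Qed.

Lemma smooth_on_open d (U : set 'rV[R]_d) M (p : 'rV[R]_d -> M) (A : set M) :
  open U -> open A -> smooth_on U p -> open (U `&` p @^-1` A).
Proof. by move=> oU oA [cp _]; exact: open_preimage_in. Qed.

Lemma smooth_on_sub d (U V : set 'rV[R]_d) M (p : 'rV[R]_d -> M) :
  V `<=` U -> smooth_on U p -> smooth_on V p.
Proof.
move=> VU [cp sp]; split=> [u /VU/cp//|c cA k].
by apply: Ck_subset (sp c cA k) => u [/VU].
Qed.

Lemma smooth_on_local d (U : set 'rV[R]_d) M (p : 'rV[R]_d -> M) :
  (forall u, U u -> exists2 V, V u & smooth_on V p) -> smooth_on U p.
Proof.
move=> h; split=> [u /h[V Vu [+ _]]|c cA]; first exact.
apply: Cinfty_open_local => u [/h[V Vu [_ sV]] pu].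
by exists (V `&` p @^-1` chart_dom c) => //; exact: sV.
Qed.

Lemma smooth_on_ext d (U : set 'rV[R]_d) M (p q : 'rV[R]_d -> M) :
  open U -> (forall u, U u -> p u = q u) -> smooth_on U p -> smooth_on U q.
Proof.
move=> oU pq sp; have [cp Cp] := sp; split=> [u Uu|c cA k].
  have npq : \forall v \near u, p v = q v.
    by apply: filterS (open_nbhs_nbhs (conj oU Uu)) => v; exact: pq.
  have : q v @[v --> u] --> p u.
    by apply: cvg_trans (cp u Uu); exact: (near_eq_cvg npq).
  by rewrite (pq _ Uu).
have -> : U `&` q @^-1` chart_dom c = U `&` p @^-1` chart_dom c.
  by apply/seteqP; split=> u [Uu] /=; rewrite pq.
apply: (@Ck_ext _ _ _ _ _ (chart_map c \o p)) (Cp c cA k).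
  by apply: smooth_on_open => //; exact: chart_dom_open.
by move=> u [Uu _] /=; rewrite pq.
Qed.

Lemma smooth_on_chart d (U : set 'rV[R]_d) M (p : 'rV[R]_d -> M) :
  open U -> (forall u, U u -> {for u, continuous p}) ->
  (forall u, U u -> exists2 c, atlas c & chart_dom c (p u) /\
    Cinfty (U `&` p @^-1` chart_dom c) (chart_map c \o p)) ->
  smooth_on U p.
Proof.
move=> oU cp h; split=> // c' cA'.
apply: Cinfty_open_local => u [Uu pu]; have [c cA [cu Cc]] := h u Uu.
exists (U `&` p @^-1` (chart_dom c `&` chart_dom c')) => // k.
have oW : open (U `&` p @^-1` (chart_dom c `&` chart_dom c')).
  by apply: open_preimage_in => //; apply: openI; exact: chart_dom_open.
apply: (@Ck_ext _ _ _ _ _ ((chart_map c' \o chart_inv c) \o (chart_map c \o p))) => //.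
  by move=> v [_ [cv _]] /=; rewrite chart_mapK.
apply: Ck_comp_rV (atlas_compat cA cA' k) _ => //.
- exact: overlap_open.
- by move=> v [_ [cv cv']] /=; rewrite chart_mapK//; split=> //; exact: chart_mapP.
- by apply: Ck_subset (Cc k) => v [Uv [cv _]].
Qed.

Lemma smooth_on_inv M (c : chart R M) :
  atlas c -> smooth_on (chart_img c) (chart_inv c).
Proof.
move=> cA; split=> [v|c' cA']; first exact: chart_inv_cont.
exact: atlas_compat.
Qed.

Lemma smooth_on_cst d (U : set 'rV[R]_d) M (x : M) : smooth_on U (fun _ => x).
Proof.
split=> [u _|c _ k]; first exact: cst_continuous.
exact: (@Ck_cst _ _ _ _ _ (chart_map c x)).
Qed.

Lemma smooth_on_precomp d e (U : set 'rV[R]_d) (V : set 'rV[R]_e) M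
    (p : 'rV[R]_d -> M) (s : 'rV[R]_e -> 'rV[R]_d) :
  open U -> open V -> (forall v, V v -> U (s v)) -> Cinfty V s ->
  smooth_on U p -> smooth_on V (p \o s).
Proof.
move=> oU oV VU Cs sp; have [cp Cp] := sp.
have cs v : V v -> {for v, continuous s} := Cs 0 v.
split=> [v Vv|c cA k].
  by apply: continuous_comp; [exact: cs|exact/cp/VU].
have oc := @chart_dom_open _ _ c.
have -> : V `&` (p \o s) @^-1` chart_dom c =
    V `&` s @^-1` (U `&` p @^-1` chart_dom c).
  by apply/seteqP; split=> v /= [Vv]; [split=> //; split=> //; exact: VU|case].
have oUp : open (U `&` p @^-1` chart_dom c) by exact: smooth_on_open.
rewrite -[_ \o (p \o s)]/((chart_map c \o p) \o s).
apply: Ck_comp_rV (Cp c cA k) _ => //; first exact: open_preimage_in.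
  by move=> v [].
by apply: Ck_subset (Cs k) => v [].
Qed.

Lemma smooth_on_comp d (U : set 'rV[R]_d) M N (p : 'rV[R]_d -> M) (g : M -> N) :
  open U -> smooth_map g -> smooth_on U p -> smooth_on U (g \o p).
Proof.
move=> oU [cg sg] sp; have [cp Cp] := sp.
have cgp u : U u -> {for u, continuous (g \o p)}.
  by move=> Uu; apply: continuous_comp; [exact: cp|exact: cg].
split=> // c' cA'; apply: Cinfty_open_local => u [Uu gpu].
have [c cA cu] := atlas_cover (p u).
exists (U `&` p @^-1` (chart_dom c `&` g @^-1` chart_dom c')) => // k.
have og : open (g @^-1` chart_dom c').
  by apply: open_comp => //; exact: chart_dom_open.
have oW : open (U `&` p @^-1` (chart_dom c `&` g @^-1` chart_dom c')).
  by apply: open_preimage_in => //; apply: openI => //; exact: chart_dom_open.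
apply: (@Ck_ext _ _ _ _ _ (in_charts g c c' \o (chart_map c \o p))) => //.
  by move=> v [_ [cv _]] /=; rewrite /in_charts /= chart_mapK.
apply: Ck_comp_rV (sg c c' cA cA' k) _ => //.
- exact: in_charts_open.
- by move=> v [_ [cv cv']] /=; rewrite chart_mapK//; split=> //; exact: chart_mapP.
- by apply: Ck_subset (Cp c cA k) => v [Uv [cv _]].
Qed.

Lemma smooth_on_fun d (U : set 'rV[R]_d) M (p : 'rV[R]_d -> M) (h : Cinf M) :
  open U -> smooth_on U p -> Cinfty U (h \o p : _ -> R^o).
Proof.
move=> oU sp; have [cp Cp] := sp; have /asboolP sh := CinfP h.
apply: Cinfty_open_local => u Uu; have [c cA cu] := atlas_cover (p u).
exists (U `&` p @^-1` chart_dom c) => // k.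
have oc := @chart_dom_open _ _ c.
apply: (@Ck_ext _ _ _ _ _ ((h \o chart_inv c : _ -> R^o) \o (chart_map c \o p))).
- exact: smooth_on_open.
- by move=> v [_ cv] /=; rewrite chart_mapK.
- apply: Ck_comp (sh c cA k) (Cp c cA k) => //; first exact: smooth_on_open.
  by move=> v [_ cv]; exact: chart_mapP.
Qed.

Lemma smooth_on_pair d (U : set 'rV[R]_d) M N (p : 'rV[R]_d -> M) (q : 'rV[R]_d -> N) :
  open U -> smooth_on U p -> smooth_on U q ->
  smooth_on U (fun u => (p u, q u) : prod_manifold M N).
Proof.
move=> oU sp sq; have [cp Cp] := sp; have [cq Cq] := sq.
split=> [u Uu|_ [c [c' [cA cA' ->]]] k].
  exact: cvg_pair (cp u Uu) (cq u Uu).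
have oc := @chart_dom_open _ _ c; have oc' := @chart_dom_open _ _ c'.
have -> : U `&` (fun u => (p u, q u)) @^-1` chart_dom (prod_chart c c') =
    (U `&` p @^-1` chart_dom c) `&` (U `&` q @^-1` chart_dom c').
  by apply/seteqP; split=> u /=; [move=> [? [? ?]]|move=> [[? ?] [? ?]]].
apply: (@Ck_row_mx _ _ _ _ _ _ (chart_map c \o p) (chart_map c' \o q)).
- by apply: openI; exact: smooth_on_open.
- by apply: Ck_subset (Cp c cA k) => u [].
- by apply: Ck_subset (Cq c' cA' k) => u [].
Qed.

End Plots.

(** * Lifting plots through embeddings and submersions *)

Section EmbeddingsAndSections.
Variable R : realType.
Implicit Types M N P : manifold R.

Lemma mulmxr_continuous n m (B : 'M[R]_(n, m)) :
  continuous (mulmxr B : 'rV[R]_n -> 'rV[R]_m).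
Proof.
move=> x; have C0 : Ck 0 setT (fun x : 'rV[R]_n => x *m B).
  by apply: Ck_mulmxr; [exact: openT|exact: Ck_id].
exact: C0.
Qed.

Lemma is_diff_mulmxr n m (B : 'M[R]_(n, m)) (x : 'rV[R]_n) :
  is_diff x (mulmxr B) (mulmxr B).
Proof.
have cB := @mulmxr_continuous _ _ B.
by apply: DiffDef; [exact: linear_differentiable|rewrite diff_lin].
Qed.

Lemma chart_preimage_open M (c : chart R M) (A : set 'rV[R]_(chart_dim c)) :
  open A -> open (chart_dom c `&` chart_map c @^-1` A).
Proof.
move=> oA; apply: open_preimage_in => //; first exact: chart_dom_open.
by move=> x; exact: chart_map_cont.
Qed.

(** The topological part of the embedding gives continuity. For smoothness, a one-sided inverse [B]
    of the injective derivative turns [g], read in charts, into a local diffeomorphism of the source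
    chart, and [p] is its inverse applied to a smooth function of [g \o p]. *)
Lemma smooth_on_embedding d (U : set 'rV[R]_d) M N (g : M -> N)
    (p : 'rV[R]_d -> M) :
  smooth_embedding g -> open U -> smooth_on U (g \o p) -> smooth_on U p.
Proof.
move=> [[[cg sg] ig] injg emb] oU sgp; have [cgp Cgp] := sgp.
have cp u : U u -> {for u, continuous p}.
  move=> Uu B; rewrite nbhsE => -[B' [oB' B'pu] B'B].
  have [V oV eV] := emb B' oB'.
  rewrite eV in B'pu.
  have h : nbhs u ((g \o p) @^-1` V) := cgp u Uu V (open_nbhs_nbhs (conj oV B'pu)).
  suff : nbhs u (p @^-1` B) by [].
  by apply: filterS h => v Vv; apply: B'B; rewrite eV.
apply: smooth_on_local => u Uu.
have [c cA cu] := atlas_cover (p u).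
have [c' cA' cu'] := atlas_cover (g (p u)).
pose O := [set v | chart_img c v /\ chart_dom c' (g (chart_inv c v))].
have oO : open O by exact: in_charts_open.
pose gc := in_charts g c c'; pose a := chart_map c (p u).
have Oa : O a by split; [exact: chart_mapP|rewrite chart_mapK].
have Cgc : Cinfty O gc := sg c c' cA cA'.
have dgc : differentiable gc a := (Cgc 1).1 a Oa.
pose J := jacobian gc a; pose B := pinvmx J.
have JB : J *m B = 1%:M.
  apply: mulmxVp; rewrite -kermx_eq0; apply/eqP/row_matrixP => i; rewrite row0.
  apply: (ig (p u) c c' cA cA' cu cu'); rewrite -/gc -/a linear0 -deriveE//.
  by rewrite deriveEjacobian// -row_mul mulmx_ker row0.
pose phi v := gc v *m B.
have Cphi : Cinfty O phi by move=> k; exact: Ck_mulmxr.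
have dphi v : 'd phi a v = v.
  have h := is_diff_comp (differentiableP dgc) (is_diff_mulmxr B (gc a)).
  rewrite -[phi]/(mulmxr B \o gc) (@diff_val _ _ _ _ _ _ _ h) /=.
  by rewrite -deriveE// deriveEjacobian// -mulmxA JB mulmx1.
have [U' [W [s [[oU' U'a U'O oW Wa] [Cs sW sU']]]]] := inverse_function oO Oa Cphi dphi.
pose D := chart_dom c `&` chart_map c @^-1` U'.
have oD : open D by exact: chart_preimage_open.
have oV : open (U `&` p @^-1` D) by exact: open_preimage_in.
exists (U `&` p @^-1` D) => //.
apply: smooth_on_chart => // [v [/cp //]|v [Uv [cv _]]].
exists c => //; split=> // k; apply: (@Ck_subset _ _ _ _ (U `&` p @^-1` D)).
  by move=> w [].
have gdom w : D (p w) -> chart_dom c' (g (p w)).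
  by move=> [cw /U'O[_]]; rewrite chart_mapK.
apply: (@Ck_ext _ _ _ _ _ (s \o (fun w => (chart_map c' \o (g \o p)) w *m B))) => //.
  move=> w [Uw [cw U'w]] /=; have [_ e] := sU' _ U'w.
  by rewrite -[RHS]e /phi /gc /in_charts /= chart_mapK.
apply: Ck_comp_rV (Cs k) _ => //.
  move=> w [Uw [cw U'w]] /=; have [+ _] := sU' _ U'w.
  by rewrite /phi /gc /in_charts /= chart_mapK.
apply: Ck_mulmxr => //.
by apply: Ck_subset (Cgp c' cA' k) => w [Uw Dw]; split=> //; exact: gdom.
Qed.

(** The rows of [B] are preimages of the basis vectors, so [aff] parametrises a slice through [x]
    transverse to the fibre; along it [g] is a local diffeomorphism, whose inverse gives the
    section. *)
Lemma submersion_section P M (g : P -> M) x : submersion g ->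
  exists O : set M, exists s : M -> P,
    [/\ open O, O (g x), forall m, O m -> g (s m) = m &
    forall d (U : set 'rV[R]_d) (q : 'rV[R]_d -> M), open U -> smooth_on U q ->
      (forall u, U u -> O (q u)) -> smooth_on U (s \o q)].
Proof.
move=> [[cg sg] surg].
have [c cA cx] := atlas_cover x; have [c' cA' cx'] := atlas_cover (g x).
pose O := [set v | chart_img c v /\ chart_dom c' (g (chart_inv c v))].
have oO : open O by exact: in_charts_open.
pose gc := in_charts g c c'; pose a := chart_map c x.
have Oa : O a by split; [exact: chart_mapP|rewrite chart_mapK].
have Cgc : Cinfty O gc := sg c c' cA cA'.
have dgc : differentiable gc a := (Cgc 1).1 a Oa.
have /choice[b hb] : forall j, exists v, 'd gc a v = delta_mx 0 j.
  by move=> j; exact: (surg x c c').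
pose B := \matrix_j b j.
have dB w : 'd gc a (w *m B) = w.
  rewrite mulmx_sum_row linear_sum [RHS]row_sum_delta; apply: eq_bigr => j _.
  by rewrite linearZ /= rowK hb.
pose aff w := a + w *m B.
have Caff (V : set _) : open V -> Cinfty V aff.
  move=> oV k; apply: (CkD oV (Ck_cst k V a)); apply: Ck_mulmxr => //; exact: Ck_id.
have daff : is_diff 0 aff (mulmxr B).
  have := is_diffD (is_diff_cst a 0) (is_diff_mulmxr B 0); rewrite add0r; exact.
have aff0 : aff 0 = a by rewrite /aff mul0mx addr0.
have oaff (V : set _) : open V -> open (aff @^-1` V).
  move=> oV; apply: open_comp => // w _; exact: (Caff setT openT 0).
pose phi := gc \o aff.
have Cphi : Cinfty (aff @^-1` O) phi.
  by move=> k; apply: Ck_comp_rV (Cgc k) _ => //; [exact: oaff|exact/Caff/oaff].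
have Oaff0 : (aff @^-1` O) 0 by rewrite /= aff0.
have dphi v : 'd phi 0 v = v.
  have dgc' : is_diff (aff 0) gc ('d gc a) by rewrite aff0; exact: differentiableP.
  by rewrite (@diff_val _ _ _ _ _ _ _ (is_diff_comp daff dgc')) /= dB.
have [U' [W [s [[oU' U'a U'O oW Wa] [Cs sW sU']]]]] :=
  inverse_function (oaff O oO) Oaff0 Cphi dphi.
pose sec m := chart_inv c (aff (s (chart_map c' m))).
exists (chart_dom c' `&` chart_map c' @^-1` W), sec; split.
- exact: chart_preimage_open.
- split=> //=; move: Wa; rewrite /phi /= aff0 /gc /in_charts /= chart_mapK//.
- move=> m [cm Wm]; have [/U'O [im dm] e] := sW _ Wm.
  rewrite -(chart_mapK dm) -[RHS](chart_mapK cm); congr chart_inv; exact: e.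
- move=> d U q oU sq qO; have [cq Cq] := sq.
  apply: (smooth_on_precomp (U := chart_img c) (s := aff \o s \o (chart_map c' \o q))) => //.
  + exact: chart_img_open.
  + by move=> u /qO[cm Wm]; have [/U'O []] := sW _ Wm.
  + move=> k.
    have oaU := openT : open (setT : set 'rV[R]_(chart_dim c')).
    apply: (Ck_comp_rV (U' := W)) => //.
    * by move=> u /qO[].
    * by apply: Ck_comp_rV (Caff _ oaU k) (Cs k).
    * by apply: Ck_subset (Cq c' cA' k) => u Uu; split=> //; have [] := qO _ Uu.
  + exact: smooth_on_inv.
Qed.

End EmbeddingsAndSections.

(** * Averaging over the fibres of a submersion *)

Section Kernel.
Variable R : realType.
Implicit Types M P : manifold R.

Definition plot_smooth M (h : M -> R) : Prop :=
  forall d (U : set 'rV[R]_d) (p : 'rV[R]_d -> M), open U -> smooth_on U p ->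
    Cinfty U (h \o p : _ -> R^o).

(** The support is compact, hence closed in the Hausdorff space [M] and not only in the chart
    domain, so the extension by [0] is smooth. Being [1] near [x], and not just at [x], is what
    makes the telescoping weights locally finite. *)
Lemma bump_function M (x : M) (O : set M) : open O -> O x ->
  exists psi : M -> R, exists C : set M,
    [/\ plot_smooth psi, \forall y \near x, psi y = 1, closed C, C `<=` O &
        forall y, ~ C y -> psi y = 0].
Proof.
move=> oO Ox; have [c cA cx] := atlas_cover x.
set n := chart_dim c; pose a := chart_map c x.
have nA : nbhs a (chart_img c `&` chart_inv c @^-1` O).
  apply: filterI.
    by apply: open_nbhs_nbhs; split; [exact: chart_img_open|exact: chart_mapP].
  apply: chart_inv_cont; first exact: chart_mapP.
  by apply: open_nbhs_nbhs; split=> //; rewrite chart_mapK.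
have /nbhs_normP[e /= e0 hA] := nA.
(* The squared Euclidean distance, because the sup norm is not smooth. *)
pose N (z : 'rV[R]_n) : R^o := \sum_j (z 0 j - a 0 j) * (z 0 j - a 0 j).
have CN (V : set 'rV[R]_n) : open V -> Cinfty V N.
  move=> oV k.
  pose sq (j : 'I_n) (z : 'rV[R]_n) : R^o := (z 0 j - a 0 j) * (z 0 j - a 0 j).
  apply: (@Ck_bigsum R _ R^o k V _ (index_enum 'I_n) xpredT sq) => // j.
  have Cj : Ck k V (fun z : 'rV[R]_n => z 0 j - a 0 j : R^o).
    apply: (CkD oV (f := fun z : 'rV[R]_n => z 0 j : R^o) (g := fun=> - a 0 j)).
      by apply: Ck_coord => //; exact: Ck_id.
    exact: Ck_cst.
  exact: (CkM oV Cj Cj).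
have cN : continuous N by move=> z; exact: (CN setT openT 0).
(* [2 r = (e/2)^2], so that [N z <= 2 r] forces every coordinate within [e/2] of [a]. *)
pose r := e ^+ 2 / 8.
have r0 : 0 < r by rewrite divr_gt0// exprn_gt0.
pose K := [set z | N z <= 2 * r].
have Ka z : K z -> `|z - a| <= e / 2.
  move=> Kz; apply: rV_norm_le => [|j]; first by rewrite divr_ge0// ltW.
  have h : (z 0 j - a 0 j) ^+ 2 <= (e / 2) ^+ 2.
    have : (z 0 j - a 0 j) * (z 0 j - a 0 j) <= N z.
      rewrite /N (bigD1 j)//= lerDl sumr_ge0// => i _; rewrite -expr2.
      exact: sqr_ge0.
    by rewrite /K /= /r in Kz; rewrite !expr2 in Kz *; lra.
  rewrite !mxE -(ger0_norm (_ : 0 <= e / 2)); last by rewrite divr_ge0// ltW.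
  by rewrite -ler_sqr ?nnegrE// !real_normK ?num_real.
have KA z : K z -> (chart_img c `&` chart_inv c @^-1` O) z.
  move=> /Ka za; apply: hA; rewrite /= distrC (le_lt_trans za)//.
  by rewrite ltr_pdivrMr// ltr_pMr// ltr1n.
have Kc : compact K.
  apply: bounded_closed_compact.
    exists (`|a| + e / 2); split; first exact: num_real.
    move=> t /ltW ht z /Ka za; apply: le_trans ht.
    rewrite /= (_ : z = a + (z - a)); last by rewrite addrC subrK.
    by apply: le_trans (ler_normD _ _) _; rewrite lerD2l.
  rewrite -/(N @^-1` [set t | t <= 2 * r]).
  apply: (preimage_closed _ (@closed_le _ _)) => z _; exact: cN.
pose C := chart_inv c @` K.
have Cc : closed C.
  apply: compact_closed; first exact: manifold_hausdorff.
  apply: continuous_compact => //; apply: continuous_in_subspaceT => z /[!inE] Kz.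
  by apply: chart_inv_cont; have [] := KA z Kz.
pose b z : R^o := flat 1 (2 * r - N z) / (flat 1 (2 * r - N z) + flat 1 (N z - r)).
have Cb (V : set 'rV[R]_n) : open V -> Cinfty V b.
  move=> oV k; apply: (Ck_flat_quot (u := fun z => 2 * r - N z) (v := fun z => N z - r)) => //.
  - move=> z _; have [h|h] := ltP (N z) (2 * r); first by left; rewrite subr_gt0.
    by right; rewrite subr_gt0; lra.
  - apply: (CkB oV (f := fun=> 2 * r) (g := N)); [exact: Ck_cst|exact: CN].
  - apply: (CkB oV (f := N) (g := fun=> r)); [exact: CN|exact: Ck_cst].
pose psi y : R := if pselect (chart_dom c y) then b (chart_map c y) else 0.
have psi0 y : ~ C y -> psi y = 0.
  rewrite /psi; case: pselect => // cy nC.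
  rewrite /b flat_le0 ?mul0r// subr_le0 leNgt; apply/negP => /ltW h.
  by apply: nC; exists (chart_map c y) => //; rewrite chart_mapK.
exists psi, C; split=> //.
- move=> d U p oU sp; have [cp Cp] := sp; apply: Cinfty_open_local => u Uu.
  have [cu|ncu] := pselect (chart_dom c (p u)).
    exists (U `&` p @^-1` chart_dom c) => // k.
    have oW : open (U `&` p @^-1` chart_dom c).
      by apply: smooth_on_open => //; exact: chart_dom_open.
    apply: (@Ck_ext _ _ _ _ _ (b \o (chart_map c \o p))) => //.
      by move=> v [_ cv] /=; rewrite /psi; case: pselect.
    by apply: Ck_comp (Cb setT openT k) (Cp c cA k).
  have nC : (~` C) (p u) by move=> [z /KA[Iz _] e']; apply: ncu; rewrite -e'; exact: chart_invP.
  exists (U `&` p @^-1` (~` C)) => // k.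
  have oW : open (U `&` p @^-1` (~` C)).
    by apply: smooth_on_open => //; exact: closed_openC.
  apply: (@Ck_ext _ _ _ _ _ (cst 0)) (Ck_cst _ _ _) => //.
  by move=> v [_ Cv] /=; rewrite psi0.
- have oD : open (chart_dom c `&` chart_map c @^-1` (N @^-1` [set t | t < r])).
    apply: chart_preimage_open; apply: open_comp; last exact: open_lt.
    by move=> z _; exact: cN.
  have Dx : (chart_dom c `&` chart_map c @^-1` (N @^-1` [set t | t < r])) x.
    split=> //; rewrite /= /N -/a big1// => j _.
    by rewrite subrr mul0r.
  apply: filterS (open_nbhs_nbhs (conj oD Dx)) => y [cy /= Ny].
  rewrite /psi; case: pselect => //= _; rewrite /b.
  have -> : flat 1 (N (chart_map c y) - r) = 0 by rewrite flat_le0// subr_le0 ltW.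
  rewrite addr0 divff// gt_eqF// flat_gt0// subr_gt0; lra.
- by move=> y [z /KA[_ Oz] <-].
Qed.

(** Lindelof's argument: one [q] is picked for each of the countably many basic open sets that fit
    inside some [one q]; [q0] fills the other indices. *)
Lemma countable_cover_choice (T : topologicalType) (Q : Type) (good : Q -> Prop)
    (one : Q -> set T) (q0 : Q) :
  @second_countable T -> good q0 ->
  (forall x : T, exists2 q, good q & nbhs x (one q)) ->
  exists s : nat -> Q, (forall k, good (s k)) /\ forall x : T, exists k, nbhs x (one (s k)).
Proof.
move=> [B /countable_injP[f finj] [oB bB]] gq0 hQ.
pose test k b q := [/\ B b, f b = k, good q & b `<=` one q].
have /choice[s hs] : forall k, exists q, good q /\
    forall b q', test k b q' -> b `<=` one q.
  move=> k; have [[b [q [Bb fb gq bq]]]|no] := pselect (exists b q, test k b q).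
    exists q; split=> // b' q' [Bb' fb' _ _].
    by rewrite (finj b' b) ?inE// fb'.
  by exists q0; split=> // b q' t; case: no; exists b, q'.
exists s; split=> [k|x]; first by have [] := hs k.
have [q gq nq] := hQ x; have [b [Bb bx] bq] := bB x _ nq.
exists (f b); apply: filterS ((hs (f b)).2 b q _) (open_nbhs_nbhs (conj (oB b Bb) bx)).
by split.
Qed.


(* If the interiors of the sets [psi j = 1] cover, these weights form a locally
   finite partition of unity, with no paracompactness needed: [tel_weight k]
   vanishes where [psi j = 1] for some [j < k]. *)
Section Telescope.
Variable psi : nat -> R.

Definition tel_weight k := psi k * \prod_(j < k) (1 - psi j).

Lemma tel_weight_sum n : \sum_(k < n) tel_weight k = 1 - \prod_(j < n) (1 - psi j).
Proof.
elim: n => [|n IHn]; first by rewrite !big_ord0 subrr.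
by rewrite !big_ord_recr /= IHn /tel_weight; ring.
Qed.

Lemma tel_weight0 j k : psi j = 1 -> (j < k)%N -> tel_weight k = 0.
Proof.
move=> pj jk; rewrite /tel_weight (bigD1 (Ordinal jk))//= pj subrr mul0r.
by rewrite mulr0.
Qed.

Lemma tel_weight_stable j n n' (F : nat -> R) : psi j = 1 -> (j < n)%N -> (n <= n')%N ->
  \sum_(k < n') tel_weight k * F k = \sum_(k < n) tel_weight k * F k.
Proof.
move=> pj jn nn'; rewrite -(subnKC nn') big_split_ord /= [X in _ + X]big1 ?addr0//.
move=> i _; rewrite (@tel_weight0 j) ?mul0r//; first exact: leq_trans (leq_addr _ _).
Qed.

End Telescope.

(** [K m] averages over finitely many points of the fibre of [m]. In the smoothness clause [H]
    depends on the parameter, because the integrand met at one face of a simplex is itself an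
    average over the choices at later faces; smoothness along local lifts of [p] suffices, as the
    sections evaluate [H] there. *)
Theorem submersion_kernel P M (g : P -> M) : submersion g ->
  (forall y, exists x, g x = y) ->
  exists K : M -> (P -> R) -> R,
    [/\ forall m a h h', K m (fun x => a * h x + h' x) = a * K m h + K m h',
        forall m a, K m (fun=> a) = a,
        forall m h h', (forall x, g x = m -> h x = h' x) -> K m h = K m h' &
        forall d (U : set 'rV[R]_d) (p : 'rV[R]_d -> M) (H : 'rV[R]_d -> P -> R),
          open U -> smooth_on U p ->
          (forall V (r : 'rV[R]_d -> P), open V -> V `<=` U -> smooth_on V r ->
            (forall v, V v -> g (r v) = p v) ->
            Cinfty V (fun v => H v (r v) : R^o)) ->
          Cinfty U (fun u => K (p u) (H u) : R^o)].
Proof.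
move=> subg /choice[s0 hs0].
(* A weight with a global set-theoretic section, smooth over an open [O] that contains the closed
   set off which the weight vanishes. *)
pose good (q : (M -> R) * (M -> P)) := [/\ plot_smooth q.1, forall m, g (q.2 m) = m &
  exists C O : set M, [/\ closed C, open O, C `<=` O, forall m, ~ C m -> q.1 m = 0 &
    forall d (U : set 'rV[R]_d) (p : 'rV[R]_d -> M), open U -> smooth_on U p ->
      (forall u, U u -> O (p u)) -> smooth_on U (q.2 \o p)]].
have good0 : good (fun=> 0, s0).
  split=> //=; first by move=> d U p oU sp k; exact: (@Ck_cst _ _ _ _ _ (0 : R^o)).
  exists set0, set0; split=> //; [exact: closed0|exact: open0|].
  move=> d U p oU sp UO; apply: smooth_on_local => u /UO [].
have good_near (m : M) : exists2 q, good q & nbhs m [set y | q.1 y = 1].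
  have [A [s [oA Om gs ss]]] := submersion_section (s0 m) subg.
  rewrite hs0 in Om; have [psi [C [spsi psi1 clC CO psi0]]] := bump_function oA Om.
  exists (psi, fun y => if pselect (A y) then s y else s0 y) => //; split=> //=.
    by move=> y; case: pselect => //= Oy; exact: gs.
  exists C, A; split=> // d U p oU sp UO.
  apply: (@smooth_on_ext _ _ _ _ (s \o p)) => //; last exact: ss.
  by move=> u Uu /=; case: pselect => //= nA; case: nA; exact: UO.
have [q [gq cq]] := countable_cover_choice (@manifold_second_countable _ M) good0 good_near.
pose psi m k := (q k).1 m; pose s k := (q k).2.
have /choice[N hN] : forall m, exists k, psi m k = 1.
  by move=> m; have [k /nbhs_singleton hk] := cq m; exists k.
(* The cut-off [N m] is an arbitrary index where [psi] is [1]; the weights vanish beyond any such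
   index, so one cut-off serves a whole neighbourhood ([KE]). *)
pose K m (h : P -> R) := \sum_(k < (N m).+1) tel_weight (psi m) k * h (s k m).
have KE m h j : psi m j = 1 -> K m h = \sum_(k < j.+1) tel_weight (psi m) k * h (s k m).
  move=> pj; have st := tel_weight_stable (psi := psi m) (fun k => h (s k m)).
  case: (leqP (N m).+1 j.+1) => [le|/ltnW le].
    by rewrite (st (N m) _ _ (hN m) _ le).
  by rewrite /K (st j _ _ pj _ le).
have swM (j : nat) d (U : set 'rV[R]_d) p : open U -> smooth_on U p ->
    Cinfty U (fun u => tel_weight (psi (p u)) j : R^o).
  move=> oU sp k.
  have Cpsi i : Ck k U (fun u => psi (p u) i : R^o).
    by have [h _ _] := gq i; exact: h.
  apply: (CkM oU (Cpsi j)).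
  apply: (Ck_prod _ _ oU) => i.
  exact: (CkB oU (Ck_cst k U (1 : R^o)) (Cpsi i)).
exists K; split.
- move=> m a h h'; rewrite /K mulr_sumr -big_split /=; apply: eq_bigr => k _; ring.
- move=> m a; rewrite /K -mulr_suml tel_weight_sum big_ord_recr /= hN.
  by rewrite subrr mulr0 subr0 mul1r.
- move=> m h h' e; rewrite /K; apply: eq_bigr => k _; congr (_ * _); apply: e.
  by have [_ h0 _] := gq k; exact: h0.
- move=> d U p H oU sp hH; apply: Cinfty_open_local => u Uu.
  have [j nj] := cq (p u).
  pose V := U `&` p @^-1` (interior [set y | psi y j = 1]).
  have oV : open V by apply: smooth_on_open => //; exact: open_interior.
  have VU : V `<=` U by move=> v [].
  exists V => [|k]; first by split.
  apply: (@Ck_ext _ _ _ _ _ (fun v => \sum_(i < j.+1)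
      tel_weight (psi (p v)) i * H v (s i (p v)) : R^o)) => //.
    by move=> v [Uv /interior_subset pj]; rewrite (KE _ _ j).
  apply: (@Ck_bigsum R _ R^o k V _ (index_enum 'I_j.+1) xpredT
    (fun i v => tel_weight (psi (p v)) i * H v (s i (p v)))) => // i.
  have [_ gs [C [A [clC oO CO psi0 ss]]]] := gq i.
  (* Over [C] the section is smooth nearby; off [C] the weight is [0] nearby, however wild the
     section. *)
  apply: Ck_local => v Vv; have [Cv|nCv] := pselect (C (p v)).
    pose W := V `&` p @^-1` A.
    have spV := smooth_on_sub VU sp.
    have oW : open W by exact: smooth_on_open.
    have WU : W `<=` U by move=> w [/VU].
    have spW := smooth_on_sub WU sp.
    exists W; first by split=> //; exact: CO.
    apply: (CkM oW); first exact: swM.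
    apply: (hH W (s i \o p)) => //; first by apply: ss => // w [].
    by move=> w _ /=; exact: gs.
  pose W := V `&` p @^-1` (~` C).
  have oW : open W.
    by apply: smooth_on_open (smooth_on_sub VU sp) => //; exact: closed_openC.
  exists W; first by split.
  apply: (@Ck_ext _ _ _ _ _ (cst (0 : R^o))) (Ck_cst _ _ _) => //.
  by move=> w [_ nC]; rewrite /tel_weight /psi psi0// !mul0r.
Qed.

End Kernel.

(** * Averaging over the fillings of a boundary square *)

Section HypercoverKernel.
Variable R : realType.

Lemma smooth_on_span_eval (X : smanifold R) (K : sset) d (U : set 'rV[R]_d)
    (p : 'rV[R]_d -> smap K (sset_of X)) (s : seq {m & K m}) :
  open U -> (forall m (x : K m), smooth_on (M := X m) U (fun u => p u m x)) ->
  smooth_on U (fun u => span_eval (p u) s).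
Proof.
move=> oU sp; elim: s => [|a s IHs] /=; first exact: (@smooth_on_cst _ _ _ (point_manifold R)).
exact: (smooth_on_pair oU (sp _ (tagged a)) IHs).
Qed.

Variables (X Y : smanifold R) (f : smooth_smap X Y).

Definition boundary_kernel n
    (K : squares f (boundary_incl n) -> (X n -> R) -> R) : Prop :=
  [/\ forall q a h h', K q (fun x => a * h x + h' x) = a * K q h + K q h',
      forall q a, K q (fun=> a) = a,
      forall q h h', (forall x, boundary_square f x = q -> h x = h' x) ->
        K q h = K q h' &
      forall d (U : set 'rV[R]_d) (q : 'rV[R]_d -> squares f (boundary_incl n))
        (H : 'rV[R]_d -> X n -> R),
        open U ->
        (forall m (t : boundary n m), smooth_on (M := X m) U (fun u => sq_left (q u) m t)) ->
        (forall m (t : Delta n m), smooth_on (M := Y m) U (fun u => sq_right (q u) m t)) ->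
        (forall V (r : 'rV[R]_d -> X n), open V -> V `<=` U -> smooth_on V r ->
          (forall v, V v -> boundary_square f (r v) = q v) ->
          Cinfty V (fun v => H v (r v) : R^o)) ->
        Cinfty U (fun u => K (q u) (H u) : R^o)].

(** Evaluation on a spanning family embeds the model of the matching space, so a family of squares
    that varies smoothly on each simplex is a plot of the model. *)
Lemma hypercover_kernel : hypercover f -> forall n, exists K, @boundary_kernel n K.
Proof.
move=> hf n; have [M [g [gE gsurj gsub]]] := hf n.
have [inv invK Kinv] := model_square_bij M.
have [K0 [Klin Kcst Ksupp Ksm]] := submersion_kernel gsub gsurj.
exists (fun q h => K0 (inv q) h); split=> //.
- move=> q h h' e; apply: Ksupp => x gx; apply: e.
  by rewrite -gE gx Kinv.
- move=> d U q H oU ql qr hH.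
  have [s [t [_ emb]]] := model_square_embedding M.
  apply: Ksm => //.
    apply: (smooth_on_embedding emb) => //.
    apply: (@smooth_on_ext _ _ _ _ (fun u => (span_eval (sq_left (q u)) s,
       span_eval (sq_right (q u)) t) : prod_manifold (span_space X s) (span_space Y t))) => //.
      by move=> u _ /=; rewrite Kinv.
    by apply: smooth_on_pair => //; exact: smooth_on_span_eval.
  move=> V r oV VU sr gr; apply: hH => // v Vv.
  by rewrite -gE gr// Kinv.
Qed.

End HypercoverKernel.

(** * Random lifts *)

Section OrdMaps.

Definition surj_map m n (s : ord_map m n) : Prop := forall i, exists j, s j = i.

Lemma surj_or_misses m n (s : ord_map m n) : surj_map s \/ misses_vertex s.
Proof.
have [|ns] := pselect (surj_map s); first by left.
right; move/existsNP: ns => [i hi]; exists i => j; apply/eqP => e.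
by apply: hi; exists j.
Qed.

Lemma surj_not_misses m n (s : ord_map m n) : surj_map s -> ~ misses_vertex s.
Proof. by move=> ss [i hi]; have [j /eqP] := ss i; rewrite (negbTE (hi j)). Qed.

Lemma ord_comp_inj l m n (e : ord_map m n) (s t : ord_map l m) :
  injective e -> ord_comp e s = ord_comp e t -> s = t.
Proof.
move=> ie h; apply: ord_mapP => i; apply: ie.
by have /(congr1 (fun u : ord_map l n => u i)) := h.
Qed.

End OrdMaps.

Lemma squares_eq (R : realType) (X Y : smanifold R) (f : smooth_smap X Y)
    (K L : sset) (i : smap K L) (q q' : squares f i) :
  (forall n x, sq_left q n x = sq_left q' n x) ->
  (forall n x, sq_right q n x = sq_right q' n x) -> q = q'.
Proof.
have ext (A B : sset) (u v : smap A B) : (forall n x, u n x = v n x) -> u = v.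
  case: u v => [u hu] [v hv] /= uv.
  have {}uv : u = v.
    by apply: functional_extensionality_dep => n; apply/funext => x; exact: uv.
  by subst v; congr SMap; exact: Prop_irrelevance.
case: q q' => [a b c] [a' b' c'] /= aa bb.
have {}aa := ext _ _ a a' aa; have {}bb := ext _ _ b b' bb; subst a' b'.
by congr Square; exact: Prop_irrelevance.
Qed.

Section RandomLift.
Variables (R : realType) (X Y : smanifold R) (f : smooth_smap X Y).
Variable K : forall n, squares f (boundary_incl n) -> (X n -> R) -> R.
Hypothesis HK : forall n, boundary_kernel (@K n).
Variable x0 : forall n, X n.

Definition face m := {k & ord_map k m}.

(* Only the values on faces that are already lifted are meaningful. *)
Definition lift_state m := forall k, ord_map k m -> X k.

Lemma lift_stateP m (phi psi : lift_state m) :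
  (forall k t, phi k t = psi k t) -> phi = psi.
Proof.
by move=> h; apply: functional_extensionality_dep => n; apply/funext => x; exact: h.
Qed.

(** A choice on the face [e] also settles its degeneracies, the [t] with the same image as [e]; for
    injective [e] the surjection is unique, so [cid] returns the right one. *)
Definition upd m (phi : lift_state m) k (e : ord_map k m) (x : X k) : lift_state m :=
  fun j t =>
    if pselect (exists s : ord_map j k, surj_map s /\ t = ord_comp e s) is left H
    then smact (sval (cid H)) x else phi j t.

Lemma upd_eq m (phi : lift_state m) k (e : ord_map k m) x j (s : ord_map j k) :
  injective e -> surj_map s -> upd phi e x (ord_comp e s) = smact s x.
Proof.
move=> ie ss; rewrite /upd; case: pselect => [H|[]]; last by exists s.
by case: cid => s' /= [_ /(ord_comp_inj ie) ->].
Qed.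

Lemma upd_neq m (phi : lift_state m) k (e : ord_map k m) x j (t : ord_map j m) :
  ~ (exists s : ord_map j k, surj_map s /\ t = ord_comp e s) ->
  upd phi e x t = phi j t.
Proof. by rewrite /upd; case: pselect. Qed.

(** The lifting problem met at [e]. It is a relation because a square can be built from [phi] only
    once [phi] is known to be simplicial on the boundary of [e]. *)
Definition matches m (y : Y m) (phi : lift_state m) k (e : ord_map k m)
    (q : squares f (boundary_incl k)) : Prop :=
  (forall j (t : boundary k j), sq_left q j t = phi j (ord_comp e t)) /\
  (forall j (t : Delta k j), sq_right q j t = smact (ord_comp e t) y).

Lemma matches_unique m (y : Y m) phi k (e : ord_map k m) q q' :
  matches y phi e q -> matches y phi e q' -> q = q'.
Proof.
by move=> [a b] [a' b']; apply: squares_eq => n x; rewrite ?a ?a' ?b ?b'.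
Qed.

(* The second branch is never reached from a good state. *)
Definition lift_face m (y : Y m) (phi : lift_state m) k (e : ord_map k m)
    (h : X k -> R) : R :=
  if pselect (exists q, matches y phi e q) is left H
  then @K k (sval (cid H)) h else h (x0 k).

Lemma lift_faceE m (y : Y m) phi k (e : ord_map k m) q h :
  matches y phi e q -> lift_face y phi e h = @K k q h.
Proof.
move=> mq; rewrite /lift_face; case: pselect => [H|[]]; last by exists q.
by case: cid => q' /= mq'; rewrite (matches_unique mq' mq).
Qed.

(** The law of a face depends on its lifting problem alone, not on the simplex in which the face
    sits; restricting random lifts to faces rests on this. *)
Lemma lift_face_congr m m' (y : Y m) (y' : Y m') phi phi' k (e : ord_map k m)
    (e' : ord_map k m') h :
  (forall q, matches y phi e q <-> matches y' phi' e' q) ->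
  lift_face y phi e h = lift_face y' phi' e' h.
Proof.
move=> mm; have [[q mq]|nq] := pselect (exists q, matches y phi e q).
  by rewrite (lift_faceE _ mq); apply/esym/lift_faceE/mm.
rewrite /lift_face; case: pselect => //= _; case: pselect => //= H.
by case: nq; have [q /mm] := H; exists q.
Qed.

Lemma lift_face_linear m (y : Y m) phi k (e : ord_map k m) a h h' :
  lift_face y phi e (fun x => a * h x + h' x) =
  a * lift_face y phi e h + lift_face y phi e h'.
Proof. by rewrite /lift_face; case: pselect => //= H; have [+ _ _ _] := HK k; exact. Qed.

Lemma lift_face_cst m (y : Y m) phi k (e : ord_map k m) a :
  lift_face y phi e (fun=> a) = a.
Proof. by rewrite /lift_face; case: pselect => //= H; have [_ + _ _] := HK k; exact. Qed.

(** The expectation of [h] over random extensions of [phi], an iterated integral with the first face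
    of [l] outermost. *)
Fixpoint lift_all m (y : Y m) (phi : lift_state m) (l : seq (face m))
    (h : lift_state m -> R) : R :=
  if l is a :: l' then
    lift_face y phi (tagged a) (fun x => lift_all y (upd phi (tagged a) x) l' h)
  else h phi.

Lemma lift_all_linear m (y : Y m) phi l a h h' :
  lift_all y phi l (fun psi => a * h psi + h' psi) =
  a * lift_all y phi l h + lift_all y phi l h'.
Proof.
elim: l phi => [//|b l IHl] phi /=; rewrite -lift_face_linear.
by congr lift_face; apply/funext => x; exact: IHl.
Qed.

Definition pull m k (al : ord_map k m) (phi : lift_state m) : lift_state k :=
  fun j t => phi j (ord_comp al t).

Lemma pull_upd m k (al : ord_map k m) (phi : lift_state m) j (e : ord_map j k) x :
  injective al -> injective e ->
  pull al (upd phi (ord_comp al e) x) = upd (pull al phi) e x.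
Proof.
move=> ial ie; apply: lift_stateP => i t; rewrite {1}/pull.
have iae : injective (ord_comp al e) by move=> u v /ial /ie.
have [[s [ss ->]]|nH] := pselect (exists s : ord_map i j, surj_map s /\ t = ord_comp e s).
  by rewrite Delta_comp !upd_eq.
rewrite !upd_neq// => -[s [ss es]]; apply: nH; exists s; split=> //.
by apply: (ord_comp_inj ial); rewrite es Delta_comp.
Qed.

Definition mapface m k (al : ord_map k m) (a : face k) : face m :=
  Tagged (fun j => ord_map j m) (ord_comp al (tagged a)).

Lemma lift_all_pull m k (al : ord_map k m) (y : Y m) phi (l : seq (face k)) h :
  injective al -> (forall a, List.In a l -> injective (tagged a)) ->
  lift_all y phi (map (mapface al) l) (fun psi => h (pull al psi)) =
  lift_all (smact al y) (pull al phi) l h.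
Proof.
move=> ial; elim: l phi => [//|a l IHl] phi il /=.
rewrite (@lift_face_congr _ _ y (smact al y) phi (pull al phi) _ _ (tagged a)).
  congr lift_face; apply/funext => x; rewrite IHl ?pull_upd//.
    by apply: il; left.
  by move=> b bl; apply: il; right.
move=> q; rewrite /matches; split=> -[h1 h2]; split=> j t.
- by rewrite h1 /pull Delta_comp.
- by rewrite h2 -smact_comp Delta_comp.
- by rewrite h1 /pull Delta_comp.
- by rewrite h2 -smact_comp Delta_comp.
Qed.

(* The maps whose image is the image of a face of [l]. *)
Definition todo m (l : seq (face m)) j (t : ord_map j m) : Prop :=
  exists2 a, List.In a l & exists s : ord_map j (tag a),
    surj_map s /\ t = ord_comp (tagged a) s.

Lemma todo_cons m a (l : seq (face m)) j (t : ord_map j m) :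
  todo (a :: l) t <-> (exists s : ord_map j (tag a),
    surj_map s /\ t = ord_comp (tagged a) s) \/ todo l t.
Proof.
split=> [[b [<-|bl] bt]|[at_|[b bl bt]]]; first by left.
- by right; exists b.
- by exists a => //; left.
- by exists b => //; right.
Qed.

(** No later face lies inside an earlier one, so when a face is reached its boundary is no longer to
    do. *)
Fixpoint ordered m (l : seq (face m)) : Prop :=
  if l is a :: l' then
    [/\ injective (tagged a),
        forall j (t : ord_map j (tag a)), ~ todo l' (ord_comp (tagged a) t) &
        ordered l']
  else True.

Lemma ordered_inj m (l : seq (face m)) a :
  ordered l -> List.In a l -> injective (tagged a).
Proof. by elim: l => [//|b l IHl] /= [ib _ ol] [<-//|]; exact: IHl. Qed.

Lemma ordered_misses m a (l : seq (face m)) j (t : ord_map j (tag a)) :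
  ordered (a :: l) -> misses_vertex t -> ~ todo (a :: l) (ord_comp (tagged a) t).
Proof.
move=> [ia al _] mt /todo_cons[[s [ss /(ord_comp_inj ia) ts]]|]; last exact: al.
by apply: (surj_not_misses ss); rewrite -ts.
Qed.

Lemma todo_filter m (l : seq (face m)) (p : pred (face m)) j (t : ord_map j m) :
  todo [seq b <- l | p b] t -> todo l t.
Proof.
move=> [a al at_]; exists a => //; elim: l al => [//|b l IHl] /=.
by case: ifP => _ /=; [move=> [->|/IHl]; [left|right]|move=> /IHl; right].
Qed.

Lemma ordered_filter m (l : seq (face m)) (p : pred (face m)) : ordered l -> ordered [seq b <- l | p b].
Proof.
elim: l => [//|a l IHl] /= [ia al ol]; case: ifP => _; last exact: IHl.
by split=> //; [move=> j t /todo_filter; exact: al|exact: IHl].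
Qed.

(** What is not to do counts as settled. A prescribed partial lift is thus encoded by leaving its
    faces out of [l], as will be done for the bottom of the prism. *)
Definition good m (y : Y m) (phi : lift_state m) (l : seq (face m)) : Prop :=
  forall j (t : ord_map j m), ~ todo l t ->
    f j (phi j t) = smact t y /\
    forall i (s : ord_map i j),
      ~ todo l (ord_comp t s) /\ phi i (ord_comp t s) = smact s (phi j t).

Lemma matches_exists m (y : Y m) phi a (l : seq (face m)) :
  ordered (a :: l) -> good y phi (a :: l) ->
  exists q, matches y phi (tagged a) q.
Proof.
case: a => k e ol gd /=.
have nat i j (s : ord_map i j) (t : boundary k j) :
    phi i (ord_comp e (sact s t : boundary k i)) = smact s (phi j (ord_comp e t)).
  have := gd j (ord_comp e t) (ordered_misses ol (boundaryP t)).
  by move=> [_ /(_ i s)[_ <-]] /=; rewrite Delta_comp.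
pose L := @SMap (boundary k) (sset_of X) (fun j t => phi j (ord_comp e t)) nat.
have natr i j (s : ord_map i j) (t : Delta k j) :
    smact (ord_comp e (sact s t : Delta k i)) y = smact s (smact (ord_comp e t) y).
  by rewrite -smact_comp /= Delta_comp.
pose Rr := @SMap (Delta k) (sset_of Y) (fun j t => smact (ord_comp e t) y) natr.
have comm n (t : boundary k n) : f n (L n t) = Rr n (boundary_incl k n t).
  by have [] := gd n (ord_comp e t) (ordered_misses ol (boundaryP t)).
by exists (Square comm); split.
Qed.

(** The equation [boundary_square f x = q] says both that [x] lies over the right face of [y] and
    that its proper faces agree with the choices already made. *)
Lemma good_upd m (y : Y m) phi a (l : seq (face m)) q (x : X (tag a)) :
  ordered (a :: l) -> good y phi (a :: l) -> matches y phi (tagged a) q ->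
  boundary_square f x = q -> good y (upd phi (tagged a) x) l.
Proof.
case: a x q => k e /= x q ol gd [mq mq'] xq; have [ie el _] := ol.
have bx j (t : ord_map j k) : misses_vertex t -> smact t x = phi j (ord_comp e t).
  by move=> mt; have := mq j (BoundarySimplex mt); rewrite -xq.
have fx : f k x = smact e y.
  have := mq' k (ord_id k); rewrite -xq /= smact_id => ->.
  by rewrite Delta_id.
move=> j t ntl.
have [[s0 [ss0 ts0]]|nt] := pselect (exists s : ord_map j k, surj_map s /\ t = ord_comp e s).
  rewrite ts0 upd_eq//; split.
    have := smap_nat f s0 x; rewrite /= => ->.
    by rewrite fx smact_comp.
  move=> i s; rewrite -Delta_comp; split; first exact: el.
  (* Either the composite still covers the face, or it falls into the boundary, where [bx] compares
     [x] with the old state. *)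
  have [ss|ms] := surj_or_misses (ord_comp s0 s); first by rewrite upd_eq// smact_comp.
  rewrite upd_neq; first by rewrite -bx// smact_comp.
  move=> [s1 [ss1 /(ord_comp_inj ie) e1]].
  by apply: (surj_not_misses ss1); rewrite -e1.
have ntc : ~ todo (Tagged _ e :: l) t by move=> /todo_cons[].
have [ft ht] := gd j t ntc; rewrite upd_neq//; split=> // i s.
have [nts pts] := ht i s; split; first by move=> h; apply: nts; apply/todo_cons; right.
rewrite upd_neq// => h; apply: nts; apply/todo_cons; left; exact: h.
Qed.

Lemma lift_face_congr_fibre m (y : Y m) phi k (e : ord_map k m) q h h' :
  matches y phi e q -> (forall x, boundary_square f x = q -> h x = h' x) ->
  lift_face y phi e h = lift_face y phi e h'.
Proof. by move=> mq hh; rewrite !(lift_faceE _ mq); have [_ _ + _] := HK k; exact. Qed.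

(** The kernels see only the fibre over their square, so every state reached is good and the final
    ones are genuine simplicial lifts of [y]. *)
Lemma lift_all_congr m (y : Y m) phi l h h' :
  ordered l -> good y phi l -> (forall psi, good y psi [::] -> h psi = h' psi) ->
  lift_all y phi l h = lift_all y phi l h'.
Proof.
move=> + + hh; elim: l phi => [|a l IHl] phi ol gd; first exact: hh.
have [q mq] := matches_exists ol gd; apply: (lift_face_congr_fibre mq) => x xq.
by apply: IHl; [have [] := ol|exact: good_upd mq xq].
Qed.

Lemma lift_all_cst m (y : Y m) phi l a : lift_all y phi l (fun=> a) = a.
Proof.
elim: l phi => [//|b l IHl] phi /=; rewrite -[RHS](lift_face_cst y phi (tagged b)).
by congr lift_face; apply/funext => x; exact: IHl.
Qed.

(** As [D] is a sieve, the lifting problem at a face of [D] reads the state only inside [D], and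
    simplices still to do are overwritten before they are read. *)
Lemma lift_all_dep m (D : forall j, ord_map j m -> Prop) (y : Y m) phi phi' l h :
  (forall i j (t : ord_map j m) (s : ord_map i j), D j t -> D i (ord_comp t s)) ->
  (forall a, List.In a l -> D _ (tagged a)) -> ordered l ->
  (forall j t, D j t -> ~ todo l t -> phi j t = phi' j t) ->
  (forall psi psi', (forall j t, D j t -> psi j t = psi' j t) -> h psi = h psi') ->
  lift_all y phi l h = lift_all y phi' l h.
Proof.
move=> dD + + + hD; elim: l phi phi' => [|a l IHl] phi phi' lD ol pp.
  by apply: hD => j t Dt; apply: pp => // -[].
have Da : D _ (tagged a) by apply: lD; left.
rewrite /= (@lift_face_congr _ _ y y phi phi' _ _ (tagged a)).
  congr lift_face; apply/funext => x; apply: IHl.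
  - by move=> b bl; apply: lD; right.
  - by have [] := ol.
  - move=> j t Dt ntl; have [ia _ _] := ol.
    have [[s [ss ->]]|nt] := pselect (exists s : ord_map j (tag a), surj_map s /\ t = ord_comp (tagged a) s).
      by rewrite !upd_eq.
    by rewrite !upd_neq//; apply: pp => // /todo_cons[].
have pb j (t : boundary (tag a) j) :
    phi j (ord_comp (tagged a) t) = phi' j (ord_comp (tagged a) t).
  by apply: pp; [exact: dD|exact: ordered_misses ol (boundaryP t)].
by move=> q; split=> -[h1 h2]; split=> // j t; rewrite h1 pb.
Qed.

Definition into m (A : {pred 'I_m.+1}) j (t : ord_map j m) : bool :=
  [forall i, A (t i)].

Lemma intoP m (A : {pred 'I_m.+1}) j (t : ord_map j m) :
  reflect (forall i, A (t i)) (into A t).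
Proof. exact: forallP. Qed.

(* Choices over faces outside [A] are integrated out, their weights having
   total mass 1; the remaining ones never look at those faces. *)
Lemma lift_all_forget m (A : {pred 'I_m.+1}) (y : Y m) phi l h :
  ordered l ->
  (forall psi psi', (forall j t, into A t -> psi j t = psi' j t) -> h psi = h psi') ->
  lift_all y phi l h = lift_all y phi [seq a <- l | into A (tagged a)] h.
Proof.
move=> + hA; elim: l phi => [//|a l IHl] phi /= [ia al ol].
case: ifP => Aa; first by congr lift_face; apply/funext => x; exact: IHl.
rewrite -[RHS](lift_face_cst y phi (tagged a)); congr lift_face; apply/funext => x.
rewrite IHl//; apply: (@lift_all_dep _ (fun j t => into A t)) => //.
- by move=> i j t s /intoP At; apply/intoP => u; exact: At.
- elim: {IHl al ol} l => [//|b l IHl] /= c; case: ifP => Ab /=; [move=> [<-//|]|]; exact: IHl.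
- exact: ordered_filter.
- move=> j t /intoP At _; rewrite upd_neq// => -[s [ss e]].
  move/negP: Aa; apply; apply/intoP => i; have [u <-] := ss i.
  by have := At u; rewrite e.
Qed.

(** The integrand at the first face is the average over the remaining ones. Along a local lift [r]
    it is smooth by the induction hypothesis, applied on a smaller open set to the state updated by
    [r]. *)
Lemma lift_all_smooth m d (U : set 'rV[R]_d) (y : 'rV[R]_d -> Y m)
    (phi : 'rV[R]_d -> lift_state m) l h :
  open U -> ordered l -> smooth_on U y ->
  (forall j t, smooth_on (M := X j) U (fun u => phi u j t)) ->
  (forall u, U u -> good (y u) (phi u) l) ->
  (forall V (psi : 'rV[R]_d -> lift_state m), open V ->
    (forall j t, smooth_on (M := X j) V (fun u => psi u j t)) ->
    Cinfty V (fun u => h (psi u) : R^o)) ->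
  Cinfty U (fun u => lift_all (y u) (phi u) l h : R^o).
Proof.
move=> + + + + + hh; elim: l U phi => [|a l IHl] U phi oU ol sy sphi gd; first exact: hh.
have /choice[q mq] : forall u, exists q, U u -> matches (y u) (phi u) (tagged a) q.
  move=> u; have [Uu|nU] := pselect (U u).
    by have [q mq] := matches_exists ol (gd u Uu); exists q.
  by exists (boundary_square f (x0 (tag a))).
have [_ _ _ Ksm] := HK (tag a).
move=> k; apply: (@Ck_ext _ _ _ _ _
  (fun u => @K _ (q u) (fun x => lift_all (y u) (upd (phi u) (tagged a) x) l h) : R^o)) => //.
  by move=> u Uu /=; rewrite (lift_faceE _ (mq u Uu)).
move: k; apply: Ksm => //.
- move=> j t; apply: (@smooth_on_ext _ _ _ _ (fun u => phi u j (ord_comp (tagged a) t))) => //.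
  by move=> u Uu; have [-> _] := mq u Uu.
- move=> j t; apply: (@smooth_on_ext _ _ _ _ (fun u => smact (ord_comp (tagged a) t) (y u))) => //.
    by move=> u Uu; have [_ ->] := mq u Uu.
  exact: (smooth_on_comp oU (smact_smooth Y (ord_comp (tagged a) t)) sy).
- move=> V r oV VU sr rq; apply: (IHl V (fun v => upd (phi v) (tagged a) (r v))) => //.
  + by have [] := ol.
  + exact: smooth_on_sub sy.
  + move=> j t; rewrite /upd; case: pselect => [H|_].
      exact: (smooth_on_comp oV (smact_smooth X (sval (cid H))) sr).
    exact: smooth_on_sub (sphi j t).
  + by move=> v Vv; apply: good_upd (rq v Vv) => //; [exact/gd/VU|exact/mq/VU].
Qed.

End RandomLift.

(** * Enumeration of the faces of a simplex *)

Section Subsequences.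
Variable T : eqType.

(** Lists without [x] come first, so a sublist precedes the lists that contain it. The enumeration
    commutes with restriction to a subset ([filter_subs]), so the faces of a face come in the
    induced order. *)
Fixpoint subs (s : seq T) : seq (seq T) :=
  if s is x :: s' then subs s' ++ map (cons x) (subs s') else [:: [::]].

Lemma filter_subs (A : pred T) s : [seq u <- subs s | all A u] = subs [seq x <- s | A x].
Proof.
elim: s => [//|x s IHs] /=; rewrite filter_cat IHs filter_map /=.
case: ifP => Ax /=.
  by rewrite (@eq_filter _ (preim (cons x) (all A)) (all A)) ?IHs// => u /=; rewrite Ax.
rewrite (@eq_filter _ (preim (cons x) (all A)) pred0) ?filter_pred0 ?cats0//.
by move=> u /=; rewrite Ax.
Qed.

Lemma mem_subs u s : (u \in subs s) = subseq u s.
Proof.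
elim: s u => [|x s IHs] u /=; first by rewrite inE; case: u.
rewrite mem_cat IHs; case: u => [|y u] /=; first by rewrite sub0seq.
have [->|xy] := eqVneq y x.
  rewrite mem_map ?IHs; last by move=> ? ? [].
  by rewrite orb_idl// => /(subseq_trans (subseq_cons u x)).
by rewrite orb_idr// => /mapP[v _ [e]]; rewrite e eqxx in xy.
Qed.

Lemma pairwise_subs s : uniq s -> pairwise (fun u v : seq T => ~~ all [in u] v) (subs s).
Proof.
elim: s => [//|x s IHs] /= /andP[xs us]; rewrite pairwise_cat pairwise_map IHs//.
have nx u : u \in subs s -> x \notin u.
  by rewrite mem_subs => /mem_subseq h; apply: contra xs => /h.
apply/and3P; split=> //.
  apply/allrelP => u v us' /mapP[w ws ->] /=.
  by rewrite negb_and (negbTE (nx u us')).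
have h : {in subs s &, forall u v, ~~ all [in u] v -> ~~ all [in x :: u] (x :: v)}.
  move=> u v us' vs; apply: contra => /=; rewrite inE eqxx /= => /allP h.
  apply/allP => z zv; have := h z zv; rewrite /= inE => /orP[/eqP zx|//].
  by rewrite zx (negbTE (nx v vs)) in zv.
apply: (sub_in_pairwise h _ (IHs us)); exact/allP.
Qed.

End Subsequences.

Lemma map_subs (T T' : eqType) (g : T -> T') s : map (map g) (subs s) = subs (map g s).
Proof.
by elim: s => [//|x s IHs] /=; rewrite map_cat IHs -IHs -!map_comp.
Qed.

Lemma ltn_sorted_eq (s t : seq nat) : sorted ltn s -> sorted ltn t -> s =i t -> s = t.
Proof. exact: (irr_sorted_eq ltn_trans ltnn). Qed.

Section Faces.

(** Faces of different dimensions have different types; their vertex lists live in one type, where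
    [subs] enumerates them. *)
Definition vals m (a : face m) : seq 'I_m.+1 := [seq tagged a i | i <- enum 'I_(tag a).+1].

Lemma size_vals m (a : face m) : size (vals a) = (tag a).+1.
Proof. by rewrite size_map size_enum_ord. Qed.

Lemma vals_inj m : injective (@vals m).
Proof.
move=> [k e] [k' e'] /= h; have /eqP := congr1 size h.
rewrite !size_vals /= eqSS => /eqP kk; subst k'.
congr existT; apply: ord_mapP => i.
by move/eq_in_map: h => /(_ i (mem_enum _ _)).
Qed.

Lemma mem_vals m (a : face m) j : reflect (exists i, tagged a i = j) (j \in vals a).
Proof.
by apply: (iffP mapP) => [[i _ ->]|[i <-]]; exists i => //; rewrite mem_enum.
Qed.

Lemma vals_mapface m k (al : ord_map k m) (a : face k) :
  vals (mapface al a) = map al (vals a).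
Proof. by rewrite /vals -map_comp. Qed.

Lemma map_val_enum m : map val (enum 'I_m) = iota 0 m.
Proof. exact: val_enum_ord. Qed.

Lemma face_of_subseq m (u : seq 'I_m.+1) : subseq u (enum 'I_m.+1) -> u != [::] ->
  exists2 a : face m, vals a = u & injective (tagged a).
Proof.
move=> su un; have su' : sorted ltn (map val u).
  by apply: (subseq_sorted ltn_trans (map_subseq val su)); rewrite map_val_enum iota_ltn_sorted.
have sz : (size u).-1.+1 = size u by case: u un {su su'}.
have ib (i : 'I_(size u).-1.+1) : (i < size u)%N.
  by apply: leq_trans (ltn_ord i) _; rewrite sz.
have lt (i j : 'I_(size u).-1.+1) : (i < j)%N -> (nth ord0 u i < nth ord0 u j)%N.
  move=> ij; have := sorted_ltn_nth ltn_trans 0%N su'.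
  move=> /(_ i j); rewrite !inE size_map !ib => /(_ isT isT ij).
  by rewrite !(nth_map ord0).
have mono (i j : 'I_(size u).-1.+1) : (i <= j)%N -> (nth ord0 u i <= nth ord0 u j)%N.
  by rewrite leq_eqVlt => /orP[/eqP/val_inj->//|/lt/ltnW].
exists (Tagged (fun k => ord_map k m) (OrdMap mono)) => /=.
  rewrite /vals /= -[RHS](mkseq_nth ord0) /mkseq -sz -val_enum_ord -map_comp.
  by apply: eq_map => i.
move=> i j /= e; apply/val_inj => /=; case: (ltngtP i j) => // /lt; rewrite e ltnn//.
Qed.

Lemma faces_exist m : exists l : seq (face m),
  (forall a, List.In a l -> injective (tagged a)) /\
  map (@vals m) l = [seq u <- subs (enum 'I_m.+1) | u != [::]].
Proof.
have : all (fun u => subseq u (enum 'I_m.+1) && (u != [::]))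
    [seq u <- subs (enum 'I_m.+1) | u != [::]].
  by apply/allP => u; rewrite mem_filter mem_subs andbC.
elim: [seq u <- _ | _] => [_|u s IHs /= /andP[/andP[su un] /IHs[l [il e]]]].
  by exists [::].
have [a va ia] := face_of_subseq su un; exists (a :: l); split; last by rewrite /= va e.
by move=> b /= [<-|/il].
Qed.

Definition faces m : seq (face m) := sval (cid (faces_exist m)).

Lemma faces_inj m a : List.In a (faces m) -> injective (tagged a).
Proof. by rewrite /faces; case: cid => l /= [+ _]; exact. Qed.

Lemma vals_faces m : map (@vals m) (faces m) = [seq u <- subs (enum 'I_m.+1) | u != [::]].
Proof. by rewrite /faces; case: cid => l /= []. Qed.

Lemma faces_ordered m : ordered (faces m).
Proof.
have := @faces_inj m.
have : pairwise (fun u v : seq 'I_m.+1 => ~~ all [in u] v) (map (@vals m) (faces m)).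
  by rewrite vals_faces; apply/pairwise_filter/pairwise_subs/enum_uniq.
elim: (faces m) => [//|a l IHl] /= /andP[al pl] il; split.
- by apply: il; left.
- move=> j t [b bl [s [ss e]]].
  have : vals b \in map (@vals m) l.
    elim: l bl {IHl al pl il} => [//|c l IHl] /= [->|/IHl]; rewrite inE ?eqxx//.
    by move->; rewrite orbT.
  move=> /(allP al)/negP; apply; apply/allP => i /mem_vals[u <-].
  have [v <-] := ss u; apply/mem_vals; exists (t v).
  by have := congr1 (fun z : ord_map j m => z v) e.
- by apply: IHl => // b bl; apply: il; right.
Qed.

Lemma in_of_vals m (l : seq (face m)) a : vals a \in map (@vals m) l -> List.In a l.
Proof.
elim: l => [//|b l IHl] /=; rewrite inE => /orP[/eqP/vals_inj->|/IHl]; first by left.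
by right.
Qed.

(** The epi-mono factorisation of [t]: its image, listed in increasing order, is the face, and
    positions in that list give the surjection. *)
Lemma todo_faces m j (t : ord_map j m) : exists2 a, List.In a (faces m) &
  (exists s : ord_map j (tag a), surj_map s /\ t = ord_comp (tagged a) s).
Proof.
pose u := [seq i <- enum 'I_m.+1 | i \in codom t].
have su : subseq u (enum 'I_m.+1) by exact: filter_subseq.
have ut i : t i \in u by rewrite mem_filter codom_f mem_enum.
have un : u != [::] by apply/eqP => e; have := ut ord0; rewrite e.
have [a va ia] := face_of_subseq su un; exists a.
  by apply: in_of_vals; rewrite va vals_faces mem_filter un mem_subs su.
have /choice[s hs] : forall i, exists l, tagged a l = t i.
  by move=> i; apply/mem_vals; rewrite va.
have mono (i i' : 'I_j.+1) : (i <= i')%N -> (s i <= s i')%N.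
  move=> ii; rewrite leqNgt; apply/negP => h.
  have := ord_fun_mono (tagged a) (ltnW h); rewrite !hs => h'.
  have e : t i = t i' by apply/val_inj/eqP; rewrite eqn_leq h' ord_fun_mono.
  by move: h; rewrite (ia (s i) (s i')) ?ltnn// !hs.
exists (OrdMap mono); split; last by apply: ord_mapP => i /=; rewrite hs.
move=> l; have : tagged a l \in u by rewrite -va; apply/mem_vals; exists l.
rewrite mem_filter => /andP[/codomP[i e] _]; exists i; apply: ia.
by rewrite hs.
Qed.

Lemma into_vals m (A : {pred 'I_m.+1}) (a : face m) : into A (tagged a) = all A (vals a).
Proof.
apply/intoP/allP => [h i /mem_vals[j <-]//|h i].
by apply: h; apply/mem_vals; exists i.
Qed.

(** An equality of lists, order included, because the order of integration in [lift_all] is that of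
    its list. *)
Lemma faces_into m k (al : ord_map k m) : injective al ->
  [seq a <- faces m | into (mem (codom al)) (tagged a)] = map (mapface al) (faces k).
Proof.
move=> ial; apply: (inj_map (@vals_inj m)).
rewrite (eq_filter (a2 := preim (@vals m) (all (mem (codom al))))); last first.
  by move=> a; rewrite into_vals.
rewrite -filter_map vals_faces -filter_predI.
rewrite (eq_filter (a2 := predI (fun u => u != [::]) (all (mem (codom al))))); last first.
  by move=> u /=; rewrite andbC.
rewrite filter_predI filter_subs.
have -> : [seq x <- enum 'I_m.+1 | mem (codom al) x] = map al (enum 'I_k.+1).
  apply: (inj_map val_inj); apply: ltn_sorted_eq.
  - apply: (subseq_sorted ltn_trans (map_subseq val (filter_subseq _ _))).
    by rewrite map_val_enum iota_ltn_sorted.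
  - rewrite sorted_map sorted_map; have := iota_ltn_sorted 0 k.+1.
    rewrite -map_val_enum sorted_map; apply: sub_sorted => i j /= ij.
    by rewrite ltn_neqAle ord_fun_mono 1?ltnW// andbT; apply: contraTneq ij => /val_inj/ial->; rewrite ltnn.
  - move=> i; apply/mapP/mapP => -[j ji ->]; exists j => //.
      by move: ji; rewrite mem_filter => /andP[/codomP[l ->] _]; rewrite map_f// mem_enum.
    by move/mapP: ji => [l _ ->]; rewrite mem_filter mem_enum andbT; exact: codom_f.
rewrite -map_comp (eq_map (g := map al \o @vals k)); last by move=> a; exact: vals_mapface.
rewrite map_comp vals_faces -map_subs filter_map; congr map.
by apply: eq_filter => -[].
Qed.

End Faces.

(** * Averaging over random lifts *)

Lemma linear_functional_sum (R : realType) (T : Type) (Phi : (T -> R) -> R) :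
  (forall a h h', Phi (fun x => a * h x + h' x) = a * Phi h + Phi h') ->
  forall n (c : R) (a : 'I_n -> R) (h : 'I_n -> T -> R),
  Phi (fun x => c * \sum_(i < n) a i * h i x) = c * \sum_(i < n) a i * Phi (h i).
Proof.
move=> lin n c a h.
have Phi0 : Phi (fun=> 0) = 0.
  rewrite (_ : (fun=> 0) = fun x : T => (-1) * 0 + 0) ?lin; first by rewrite mulN1r addNr.
  by apply/funext => x; rewrite mulr0 addr0.
have Phiz b g : Phi (fun x => b * g x) = b * Phi g.
  rewrite (_ : (fun x => b * g x) = fun x => b * g x + 0) ?lin ?Phi0 ?addr0//.
  by apply/funext => x; rewrite addr0.
rewrite Phiz; congr (_ * _).
elim: n a h => [|n IHn] a h.
  rewrite big_ord0 (_ : (fun _ => _) = fun=> 0)//.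
  by apply/funext => x; rewrite big_ord0.
rewrite big_ord_recl -IHn -lin; congr Phi; apply/funext => x.
by rewrite big_ord_recl.
Qed.

(** * The alternating sum over the simplices of a prism *)

Section Prism.
Variable R : realType.

(** [a i j] stands for the value on the [i]-th face of the [j]-th simplex of the prism, [b i j] for
    that on the [j]-th simplex of the prism over the [i]-th face. Faces away from the vertical edge
    belong to smaller prisms; those next to it are shared by neighbours and telescope, leaving the
    top [a 0 0] and the bottom [a n.+1 n]. *)
Lemma prism_sum n (a b : nat -> nat -> R) :
  (forall i j, (i < j <= n)%N -> a i j = b i j.-1) ->
  (forall i j, (j.+1 < i <= n.+1)%N -> a i j = b i.-1 j) ->
  (forall j, (j < n)%N -> a j.+1 j = a j.+1 j.+1) ->
  \sum_(0 <= j < n.+1) \sum_(0 <= i < n.+2) (-1) ^+ (i + j) * a i j =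
  a 0 0 - a n.+1 n - \sum_(0 <= j < n) \sum_(0 <= i < n.+1) (-1) ^+ (i + j) * b i j.
Proof.
move=> alt agt atel.
pose c i j := (-1) ^+ (i + j) * b i j.
have row j : (j < n.+1)%N -> \sum_(0 <= i < n.+2) (-1) ^+ (i + j) * a i j =
    (a j j - a j.+1 j) - (\sum_(0 <= i < j) c i j.-1 + \sum_(j.+1 <= i < n.+1) c i j).
  move=> jn.
  rewrite (@big_cat_nat _ _ _ j)//=; last by lia.
  rewrite [X in _ + X]big_ltn; last by lia.
  rewrite [X in _ + (_ + X)]big_ltn; last by lia.
  have -> : \sum_(0 <= i < j) (-1) ^+ (i + j) * a i j = - \sum_(0 <= i < j) c i j.-1.
    rewrite -sumrN; apply: eq_big_nat => i /andP[_ ij]; rewrite alt; last by lia.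
    by rewrite /c (_ : (i + j = (i + j.-1).+1)%N) ?exprS; [ring|lia].
  have -> : \sum_(j.+2 <= i < n.+2) (-1) ^+ (i + j) * a i j = - \sum_(j.+1 <= i < n.+1) c i j.
    rewrite big_add1 /= -sumrN; apply: eq_big_nat => i /andP[ij ii]; rewrite agt; last by lia.
    by rewrite /c /= addSn exprS; ring.
  rewrite addSn exprS addnn -mul2n exprM sqrrN !expr1n; ring.
rewrite (eq_big_nat _ _ (F2 := fun j => (a j j - a j.+1 j) -
    (\sum_(0 <= i < j) c i j.-1 + \sum_(j.+1 <= i < n.+1) c i j))); last first.
  by move=> j /andP[_ jn]; exact: row.
rewrite sumrB; congr (_ - _).
  (* The diagonal, continued by the bottom face at [j = n + 1], so that the whole difference
     telescopes. *)
  pose t j := if (j <= n)%N then a j j else a j j.-1.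
  rewrite (eq_big_nat _ _ (F2 := fun j => - (t j.+1 - t j))); last first.
    move=> j /andP[_ jn]; rewrite opprB /t.
    have -> : (j <= n)%N by lia.
    by case: ltnP => h //=; rewrite atel.
  by rewrite sumrN telescope_sumr// opprB /t ltnn.
rewrite big_split /= big_nat_recl//= [X in X + _ + _]big_geq// add0r.
rewrite [X in _ + X]big_nat_recr//= [X in _ + (_ + X)]big_geq// addr0 -big_split /=.
apply: eq_big_nat => j /andP[_ jn].
by rewrite [RHS](@big_cat_nat _ _ _ j.+1)//=; lia.
Qed.

End Prism.

(** * The averaging cochain map and the prism homotopy *)

Section Transfer.
Variables (R : realType) (X Y : smanifold R) (f : smooth_smap X Y).
Variable K : forall n, squares f (boundary_incl n) -> (X n -> R) -> R.
Hypothesis HK : forall n, boundary_kernel (@K n).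
Variable x0 : forall n, X n.

Local Notation lift_all := (@lift_all R X Y f K x0 _).

Definition ev m k (g : X k -> R) (al : ord_map k m) (psi : lift_state X m) : R :=
  g (psi k al).

Lemma ord_id_comp m n (t : ord_map m n) : ord_comp (ord_id n) t = t.
Proof. exact: ord_mapP. Qed.

(** The choices outside the image of [al] are integrated out, and the remaining ones are those made
    in lifting [smact al y]. *)
Lemma lift_all_restrict m k (al : ord_map k m) (l : seq (face m)) (l' : seq (face k))
    (y : Y m) phi h :
  injective al -> ordered l -> (forall a, List.In a l' -> injective (tagged a)) ->
  [seq a <- l | into (mem (codom al)) (tagged a)] = map (mapface al) l' ->
  lift_all y phi l (fun psi => h (pull al psi)) = lift_all (smact al y) (pull al phi) l' h.
Proof.
move=> ial ol il' e; rewrite (lift_all_forget HK x0 (A := mem (codom al)))//.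
  by rewrite e; exact: lift_all_pull.
move=> psi psi' pp; congr h; apply: lift_stateP => j t; apply: pp.
by apply/intoP => i; exact: codom_f.
Qed.

Lemma good_faces n (y : Y n) (phi : lift_state X n) : good f y phi (faces n).
Proof. by move=> j t []; have [a al at_] := todo_faces t; exists a. Qed.

Lemma lift_all_ev_face m k j (g : X j -> R) (al : ord_map k m) (be : ord_map j k)
    (y : Y m) phi l :
  ordered l -> good f y phi l ->
  lift_all y phi l (ev (fun x => g (smact be x)) al) =
  lift_all y phi l (ev g (ord_comp al be)).
Proof.
move=> ol gd; apply: (lift_all_congr HK x0) => // psi gpsi; rewrite /ev.
have nt : ~ todo [::] al by case.
by have [_ /(_ j be)[_ ->]] := gpsi k al nt.
Qed.

Definition avg n (g : X n -> R) (y : Y n) : R :=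
  lift_all y (fun k _ => x0 k) (faces n) (ev g (ord_id n)).

Lemma avg_linear n (y : Y n) a g g' :
  avg (fun x => a * g x + g' x) y = a * avg g y + avg g' y.
Proof. exact: (lift_all_linear HK x0). Qed.

(** Every simplex is to do at the start, so the initial state is overwritten. *)
Lemma lift_all_avg n (y : Y n) phi (g : X n -> R) :
  lift_all y phi (faces n) (ev g (ord_id n)) = avg g y.
Proof.
apply: (lift_all_dep (@K) x0 (D := fun _ _ => True)) => //.
- exact: faces_ordered.
- by move=> j t _ []; have [a al at_] := todo_faces t; exists a.
- by move=> psi psi' pp; rewrite /ev pp.
Qed.

Lemma avg_act m k (al : ord_map k m) (g : X k -> R) (y : Y m) : injective al ->
  avg (fun x => g (smact al x)) y = avg g (smact al y).
Proof.
move=> ial; rewrite {1}/avg lift_all_ev_face; [|exact: faces_ordered|exact: good_faces].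
rewrite ord_id_comp -(lift_all_avg _ (pull al (fun k _ => x0 k))).
rewrite -(@lift_all_restrict _ _ al (faces m)) //.
- by congr lift_all; apply/funext => psi; rewrite /pull /ev Delta_id.
- exact: faces_ordered.
- by move=> a; exact: faces_inj.
- exact: faces_into.
Qed.

Lemma avg_pullback n (g : Y n -> R) (y : Y n) : avg (fun x => g (f n x)) y = g y.
Proof.
rewrite /avg (lift_all_congr HK x0 (h' := fun=> g y)).
- by rewrite (lift_all_cst HK x0).
- exact: faces_ordered.
- exact: good_faces.
- move=> psi gpsi; rewrite /ev; have nt : ~ todo [::] (ord_id n) by case.
  by have [-> _] := gpsi n (ord_id n) nt; rewrite smact_id.
Qed.

Lemma smooth_ev d m k (g : Cinf (X k)) (al : ord_map k m) (V : set 'rV[R]_d)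
    (psi : 'rV[R]_d -> lift_state X m) : open V ->
  (forall j t, smooth_on (M := X j) V (fun u => psi u j t)) ->
  Cinfty V (fun u => ev g al (psi u) : R^o).
Proof. by move=> oV spsi; exact: (smooth_on_fun g oV (spsi k al)). Qed.

Fact avg_smooth n (g : Cinf (X n)) : avg g \in @smooth_fun R (Y n).
Proof.
apply/asboolP => c cA; have oc := @chart_img_open _ _ c.
apply: (lift_all_smooth HK x0 (y := chart_inv c) (phi := fun _ k _ => x0 k)) => //.
- exact: faces_ordered.
- exact: smooth_on_inv.
- by move=> j t; exact: smooth_on_cst.
- by move=> u _; exact: good_faces.
- by move=> V psi oV spsi; exact: smooth_ev.
Qed.

Definition Avg n (g : Cinf (X n)) : Cinf (Y n) := MkCinf (avg_smooth g).

Lemma CinfE (M : manifold R) (g h : Cinf M) : (forall x, g x = h x) -> g = h.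
Proof. by move=> gh; apply/val_inj/funext. Qed.

Lemma Avg0 n : Avg (0 : Cinf (X n)) = 0.
Proof. by apply: CinfE => y; exact: (avg_pullback (fun=> 0)). Qed.

Lemma Avg_cochain_map n (g : Cinf (Y n)) : Avg (cochain_map f n g) = g.
Proof. by apply: CinfE => y; exact: (avg_pullback g). Qed.

Lemma coface_inj n (i : 'I_n.+2) : injective (coface i).
Proof. exact: lift_inj. Qed.

Lemma delta_Avg n (g : Cinf (X n)) : delta (Avg g) = Avg (delta g).
Proof.
apply: CinfE => y; rewrite deltaE.
have -> : Avg (delta g) y = avg (fun x => (-1) ^+ n.+1 * \sum_(i < n.+2) (-1) ^+ i * g (smact (coface i) x)) y.
  by congr (avg _ y); apply/funext => x; exact: deltaE.
rewrite (linear_functional_sum (Phi := fun h => avg h y)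
  (fun a h h' => avg_linear y a h h') _ _ (fun i x => g (smact (coface i) x))).
congr (_ * _); apply: eq_bigr => i _; congr (_ * _).
by rewrite avg_act//; exact: coface_inj.
Qed.

(* The prism over [Delta n] is a subcomplex of [Delta (2n+1)], the vertex
   [(v, e)] of the prism being the vertex [2v + e]. *)
Fact half_bound n (i : 'I_n.*2.+2) : (i./2 < n.+1)%N.
Proof. by have := ltn_ord i; lia. Qed.
Fact half_mono n (i j : 'I_n.*2.+2) : (i <= j)%N ->
  (Ordinal (half_bound i) <= Ordinal (half_bound j))%N.
Proof. by move=> /=; lia. Qed.
Definition half n : ord_map n.*2.+1 n := OrdMap (@half_mono n).

Fact bottom_bound n (i : 'I_n.+1) : (i.*2 < n.*2.+2)%N.
Proof. by have := ltn_ord i; lia. Qed.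
Fact bottom_mono n (i j : 'I_n.+1) : (i <= j)%N ->
  (Ordinal (bottom_bound i) <= Ordinal (bottom_bound j))%N.
Proof. by move=> /=; lia. Qed.
Definition bottom n : ord_map n n.*2.+1 := OrdMap (@bottom_mono n).

Fact top_bound n (i : 'I_n.+1) : (i.*2.+1 < n.*2.+2)%N.
Proof. by have := ltn_ord i; lia. Qed.
Fact top_mono n (i j : 'I_n.+1) : (i <= j)%N ->
  (Ordinal (top_bound i) <= Ordinal (top_bound j))%N.
Proof. by move=> /=; lia. Qed.
Definition top n : ord_map n n.*2.+1 := OrdMap (@top_mono n).

Fact prism_coface_bound n (i : 'I_n.+2) (t : 'I_n.*2.+2) :
  ((bump i t./2).*2 + odd t < n.+1.*2.+2)%N.
Proof. by have := ltn_ord t; rewrite /bump; lia. Qed.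
Fact prism_coface_mono n (i : 'I_n.+2) (t u : 'I_n.*2.+2) : (t <= u)%N ->
  (Ordinal (prism_coface_bound i t) <= Ordinal (prism_coface_bound i u))%N.
Proof. by rewrite /= /bump; lia. Qed.
Definition prism_coface n (i : 'I_n.+2) : ord_map n.*2.+1 n.+1.*2.+1 :=
  OrdMap (@prism_coface_mono n i).

Fact shuffle_bound n (j : 'I_n.+1) (i : 'I_n.+2) :
  ((if (i <= j)%N then i.*2 else i.*2.-1) < n.*2.+2)%N.
Proof. by have := ltn_ord j; have := ltn_ord i; case: ifP; lia. Qed.
Fact shuffle_mono n (j : 'I_n.+1) (i i' : 'I_n.+2) : (i <= i')%N ->
  (Ordinal (shuffle_bound j i) <= Ordinal (shuffle_bound j i'))%N.
Proof. by move=> /=; case: ifP; case: ifP; lia. Qed.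
(** The [j]-th top-dimensional simplex of the standard triangulation of the prism, with vertices
    [(0,0), ..., (j,0), (j,1), ..., (n,1)]. *)
Definition shuffle n (j : 'I_n.+1) : ord_map n.+1 n.*2.+1 := OrdMap (@shuffle_mono n j).

Definition even_vertex n : {pred 'I_n} := [pred i : 'I_n | ~~ odd i].

(** Faces with bottom vertices only are left out, since [x] is prescribed there. Lifting all the
    others, even those outside the prism, allows [lift_all] to be used as it stands; having total
    mass [1], the extra choices do not affect averages over the prism. *)
Definition prism_faces n : seq (face n.*2.+1) :=
  [seq a <- faces n.*2.+1 | ~~ into (@even_vertex _) (tagged a)].

Lemma prism_faces_ordered n : ordered (prism_faces n).
Proof. exact/ordered_filter/faces_ordered. Qed.

Definition prism_base n (x : X n) : Y n.*2.+1 := smact (half n) (f n x).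

(** The constant prism on [x], of which only the bottom survives the random choices. *)
Definition prism_init n (x : X n) : lift_state X n.*2.+1 :=
  fun j t => smact (ord_comp (half n) t) x.

Definition prism_avg n k (g : X k -> R) (al : ord_map k n.*2.+1) (x : X n) : R :=
  lift_all (prism_base x) (prism_init x) (prism_faces n) (ev g al).

Lemma todo_prism n j (t : ord_map j n.*2.+1) :
  todo (prism_faces n) t <-> ~~ into (@even_vertex _) t.
Proof.
have aux (a : face n.*2.+1) (s : ord_map j (tag a)) : surj_map s -> t = ord_comp (tagged a) s ->
    into (@even_vertex _) (tagged a) = into (@even_vertex _) t.
  move=> ss ->; apply/intoP/intoP => h i; first exact: h.
  by have [u <-] := ss i; exact: h.
split=> [[a al [s [ss ts]]]|nt].
  rewrite -(aux a s ss ts); move: al; rewrite /prism_faces {s ss ts}.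
  elim: (faces _) => [//|b l IHl] /=.
  by case: ifP => nb /=; [move=> [<-//|]|]; exact: IHl.
have [a al [s [ss ts]]] := todo_faces t; exists a; last by exists s.
have : ~~ into (@even_vertex _) (tagged a) by rewrite (aux a s).
rewrite /prism_faces; elim: (faces _) al => [//|b l IHl] /= [->|al] na.
  by rewrite na; left.
by case: ifP => _; [right|]; exact: IHl.
Qed.

Lemma prism_good n (x : X n) : good f (prism_base x) (prism_init x) (prism_faces n).
Proof.
move=> j t /todo_prism/negP; rewrite negbK => /intoP et; split.
    rewrite /prism_init /prism_base; have := smap_nat f (ord_comp (half n) t) x => /= ->; exact: smact_comp.
move=> i s; split; last by rewrite /prism_init Delta_comp smact_comp.
by move=> /todo_prism /negP; apply; apply/intoP => u; exact: et.
Qed.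

Lemma prism_avg_linear n k (al : ord_map k n.*2.+1) (x : X n) a g g' :
  prism_avg (fun x => a * g x + g' x) al x = a * prism_avg g al x + prism_avg g' al x.
Proof. exact: (lift_all_linear HK x0). Qed.

Lemma prism_avg_act n k j (g : X j -> R) (al : ord_map k n.*2.+1) (be : ord_map j k) (x : X n) :
  prism_avg (fun x => g (smact be x)) al x = prism_avg g (ord_comp al be) x.
Proof. by apply: lift_all_ev_face; [exact: prism_faces_ordered|exact: prism_good]. Qed.

Fact prism_avg_smooth n k (g : Cinf (X k)) (al : ord_map k n.*2.+1) :
  prism_avg g al \in @smooth_fun R (X n).
Proof.
apply/asboolP => c cA; have oc := @chart_img_open _ _ c.
have sc := smooth_on_inv cA.
apply: (lift_all_smooth HK x0 (y := fun u => prism_base (chart_inv c u))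
  (phi := fun u => prism_init (chart_inv c u))) => //.
- exact: prism_faces_ordered.
- apply: (smooth_on_comp oc (smact_smooth Y (half n))).
  exact: (smooth_on_comp oc (smooth_smapP f n) sc).
- move=> j t; exact: (smooth_on_comp oc (smact_smooth X (ord_comp (half n) t)) sc).
- by move=> u _; exact: prism_good.
- by move=> V psi oV spsi; exact: smooth_ev.
Qed.

(** A bottom simplex depends on bottom faces alone, where no choice is made. *)
Lemma prism_avg_bottom n (g : X n -> R) (x : X n) : prism_avg g (bottom n) x = g x.
Proof.
rewrite /prism_avg (lift_all_forget HK x0 (A := @even_vertex _)).
- rewrite /prism_faces -filter_predI (@eq_filter _ _ pred0).
    rewrite filter_pred0 /= /ev /prism_init (_ : ord_comp _ _ = ord_id n) ?smact_id//.
    by apply: ord_mapP => i; apply: val_inj => /=; lia.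
  by move=> a /=; rewrite andbN.
- exact: prism_faces_ordered.
- move=> psi psi' pp; rewrite /ev pp//; apply/intoP => i /=.
  by rewrite /even_vertex /= odd_double.
Qed.

(** Faces of the top have odd vertices only, so all of them are chosen at random: the top is a full
    random lift of [f x]. *)
Lemma prism_avg_top n (g : X n -> R) (x : X n) : prism_avg g (top n) x = avg g (f n x).
Proof.
have it : injective (top n).
  by move=> i j /(congr1 val) /= h; apply: val_inj => /=; lia.
rewrite -(lift_all_avg (f n x) (pull (top n) (prism_init x)) g).
have e : smact (top n) (prism_base x) = f n x.
  rewrite /prism_base -smact_comp (_ : ord_comp _ _ = ord_id n) ?smact_id//.
  by apply: ord_mapP => i; apply: val_inj => /=; lia.
rewrite -[in RHS]e -(@lift_all_restrict _ _ (top n) (prism_faces n)) //.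
- exact: prism_faces_ordered.
- by move=> a; exact: faces_inj.
- rewrite -faces_into// /prism_faces -filter_predI; apply: eq_filter => a /=.
  apply: andb_idr => /intoP h; apply/negP => /intoP h'.
  have /codomP[i e'] := h ord0; have := h' ord0.
  by rewrite e' /even_vertex /= odd_double.
Qed.

(** [prism_coface i] preserves parity, hence the prescribed part, and is compatible with [half]; so
    the prism over a face of [x] is a restriction of the prism over [x]. *)
Lemma prism_avg_coface n k (i : 'I_n.+2) (g : X k -> R) (al : ord_map k n.*2.+1)
    (x : X n.+1) :
  prism_avg g al (smact (coface i) x) = prism_avg g (ord_comp (prism_coface i) al) x.
Proof.
have ip : injective (prism_coface i).
  move=> t u /(congr1 val) /=; rewrite /bump => h; apply: val_inj => /=; lia.
have hd : ord_comp (half n.+1) (prism_coface i) = ord_comp (coface i) (half n).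
  by apply: ord_mapP => t; apply: val_inj => /=; rewrite /bump; lia.
rewrite /prism_avg.
have -> : prism_base (smact (coface i) x) = smact (prism_coface i) (prism_base x).
  by rewrite /prism_base (smap_nat f) -!smact_comp hd.
have -> : prism_init (smact (coface i) x) = pull (prism_coface i) (prism_init x).
  apply: lift_stateP => j t; rewrite /pull /prism_init -smact_comp.
  by rewrite !Delta_comp hd.
rewrite -(@lift_all_restrict _ _ (prism_coface i) (prism_faces n.+1)) //.
- exact: prism_faces_ordered.
- by move=> a; apply: ordered_inj; exact: prism_faces_ordered.
- rewrite /prism_faces -filter_predI.
  rewrite (@eq_filter _ _ (predI (fun a => ~~ into (@even_vertex _) (tagged a))
    (fun a => into (mem (codom (prism_coface i))) (tagged a)))); last first.
    by move=> a /=; rewrite andbC.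
  rewrite filter_predI faces_into// filter_map; congr map; apply: eq_filter => a /=.
  congr (~~ _); apply: eq_forallb => t /=; congr (~~ _).
  by rewrite /=; lia.
Qed.

Fact homotopy_smooth n (g : Cinf (X n.+1)) :
  (fun x => \sum_(j < n.+1) (-1) ^+ j * prism_avg g (shuffle j) x) \in @smooth_fun R (X n).
Proof.
apply/asboolP => c cA k; have oc := @chart_img_open _ _ c.
apply: (@Ck_bigsum R _ R^o k _ _ (index_enum 'I_n.+1) xpredT
  (fun j u => (-1) ^+ j * prism_avg g (shuffle j) (chart_inv c u))) => // j.
apply: (CkZ (W := R^o) _ oc).
by have /asboolP h := prism_avg_smooth g (shuffle j); exact: h.
Qed.

Definition homotopy n (g : Cinf (X n.+1)) : Cinf (X n) := MkCinf (homotopy_smooth g).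

Lemma shuffle_coface_lt n (i : 'I_n.+3) (j : 'I_n.+2) : (i < j)%N ->
  ord_comp (shuffle j) (coface i) =
  ord_comp (prism_coface (inord i)) (shuffle (inord j.-1)).
Proof.
move=> ij; have := ltn_ord j => jn; apply: ord_mapP => t; apply: val_inj => /=.
rewrite !inordK; [|lia..]; rewrite /bump; have := ltn_ord t.
by repeat (case: ifP => ?); lia.
Qed.

Lemma shuffle_coface_gt n (i : 'I_n.+3) (j : 'I_n.+2) : (j.+1 < i)%N ->
  ord_comp (shuffle j) (coface i) =
  ord_comp (prism_coface (inord i.-1)) (shuffle (inord j)).
Proof.
move=> ij; have := ltn_ord i => jn; apply: ord_mapP => t; apply: val_inj => /=.
rewrite !inordK; [|lia..]; rewrite /bump; have := ltn_ord t.
by repeat (case: ifP => ?); lia.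
Qed.

(** Both sides are the simplex [(0,0), ..., (j,0), (j+1,1), ..., (n,1)] shared by two consecutive
    simplices of the prism. *)
Lemma shuffle_coface_eq n (i : 'I_n.+2) (j j' : 'I_n.+1) : i = j.+1 :> nat -> i = j' :> nat ->
  ord_comp (shuffle j) (coface i) = ord_comp (shuffle j') (coface i).
Proof.
move=> ij ij'; apply: ord_mapP => t; apply: val_inj => /=.
by rewrite /bump; repeat (case: ifP => ?); lia.
Qed.

Lemma shuffle_top n (i : 'I_n.+2) (j : 'I_n.+1) : i = 0 :> nat -> j = 0 :> nat ->
  ord_comp (shuffle j) (coface i) = top n.
Proof.
move=> i0 j0; apply: ord_mapP => t; apply: val_inj => /=.
by rewrite /bump; repeat (case: ifP => ?); lia.
Qed.

Lemma shuffle_bottom n (i : 'I_n.+2) (j : 'I_n.+1) : i = n.+1 :> nat -> j = n :> nat ->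
  ord_comp (shuffle j) (coface i) = bottom n.
Proof.
move=> i0 j0; apply: ord_mapP => t; apply: val_inj => /=.
by have := ltn_ord t; rewrite /bump; repeat (case: ifP => ?); lia.
Qed.

(** Each inner sum is, up to sign, an average of [delta z]. Cohomology only needs the homotopy
    formula on cocycles, where its term in [delta z] disappears. *)
Lemma prism_cocycle n (z : Cinf (X n)) (x : X n) : delta z = 0 ->
  \sum_(0 <= j < n.+1) \sum_(0 <= i < n.+2) (-1) ^+ (i + j) *
    prism_avg z (ord_comp (shuffle (inord j)) (coface (inord i))) x = 0.
Proof.
move=> dz; rewrite big_nat big1// => j /andP[_ jn].
have : prism_avg (delta z) (shuffle (inord j)) x = 0.
  have := prism_avg_linear (shuffle (inord j)) x (-1) (fun=> 0) (fun=> 0).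
  rewrite dz (_ : (fun _ => _ + _) = Cinf_val 0); first by move=> ->; rewrite mulN1r addNr.
  by apply/funext => w; rewrite mulr0 addr0.
rewrite (_ : Cinf_val (delta z) = fun w => (-1) ^+ n.+1 *
    \sum_(i < n.+2) (-1) ^+ i * z (smact (coface i) w)); last first.
  by apply/funext => w; exact: deltaE.
rewrite (linear_functional_sum (Phi := fun h => prism_avg h (shuffle (inord j)) x)
  (fun a h h' => prism_avg_linear _ x a h h') _ _ (fun i w => z (smact (coface i) w))).
move=> /eqP; rewrite mulf_eq0 signr_eq0 /= => /eqP h.
apply: etrans (etrans (congr1 (fun t => (-1) ^+ j * t) h) (mulr0 _)).
rewrite big_mkord mulr_sumr; apply: eq_bigr => i _.
by rewrite prism_avg_act inord_val exprD; ring.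
Qed.

(** In degree [0] the prism is an edge without side faces, so the values at its two ends agree. *)
Lemma Avg_cocycle0 (z : Cinf (X 0)) : delta z = 0 -> cochain_map f 0 (Avg z) = z.
Proof.
move=> dz; apply: CinfE => x; have := prism_cocycle x dz.
rewrite (@prism_sum _ 0 _ (fun _ _ => 0)); [|lia..].
rewrite [X in _ - X]big_geq// subr0 (@shuffle_top 0) ?inordK// (@shuffle_bottom 0) ?inordK//.
rewrite prism_avg_top prism_avg_bottom => /eqP; rewrite subr_eq0 => /eqP; exact.
Qed.

(** The sign cancels the factor [(-1) ^+ n.+1] built into [delta]. *)
Lemma Avg_cocycleS n (z : Cinf (X n.+1)) : delta z = 0 ->
  cochain_map f n.+1 (Avg z) - z = (-1) ^+ n.+1 *: delta (homotopy z).
Proof.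
move=> dz; apply: CinfE => x; have := prism_cocycle x dz.
rewrite (@prism_sum _ n.+1 _ (fun i j =>
  prism_avg z (ord_comp (prism_coface (inord i)) (shuffle (inord j))) x)).
- rewrite (@shuffle_top n.+1) ?inordK// (@shuffle_bottom n.+1) ?inordK//.
  rewrite prism_avg_top prism_avg_bottom => /eqP; rewrite subr_eq0 => /eqP h.
  change (avg z (f n.+1 x) - z x = (-1) ^+ n.+1 * delta (homotopy z) x).
  rewrite h deltaE signrMK.
  rewrite exchange_big_nat /= big_mkord; apply: eq_bigr => i _.
  rewrite big_mkord /= mulr_sumr; apply: eq_bigr => j _.
  by rewrite !inord_val prism_avg_coface exprD mulrA.
- move=> i j /andP[ij jn]; congr (prism_avg z _ x).
  by rewrite shuffle_coface_lt !inordK//; lia.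
- move=> i j /andP[ij jn]; congr (prism_avg z _ x).
  by rewrite shuffle_coface_gt !inordK//; lia.
- move=> j jn; congr (prism_avg z _ x).
  by apply: shuffle_coface_eq; rewrite !inordK//; lia.
Qed.

End Transfer.

(** * Passage to cohomology *)

Section Cohomology.
Variables (R : realType) (X Y : smanifold R) (f : smooth_smap X Y).

Lemma bijective_of_inj_surj (A B : Type) (h : A -> B) :
  injective h -> (forall b, exists a, h a = b) -> bijective h.
Proof.
by move=> ih /choice[g gh]; exists g => // a; apply: ih; rewrite gh.
Qed.

Lemma cohomology_map_bij n :
  (forall z : cocycles Y n, cocycle_map f z \in @exact_cocycle R X n ->
     z \in @exact_cocycle R Y n) ->
  (forall z : cocycles X n, exists w : cocycles Y n,
     cocycle_map f w - z \in @exact_cocycle R X n) ->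
  bijective (cohomology_map f n).
Proof.
move=> hinj hsurj.
have piP (W : smanifold R) (a : cohomology W n) :
    exists z, a = lquot_pi (@exact_submod_closed R W n) z.
  by exists (repr a); rewrite /lquot_pi reprK.
apply: bijective_of_inj_surj => [a b|b].
  have [z ->] := piP _ a; have [w ->] := piP _ b; rewrite !cohomology_mapE.
  move=> /lquotP h; apply/lquotP; apply: hinj.
  by rewrite linearB.
have [z ->] := piP _ b; have [w hw] := hsurj z.
by exists (lquot_pi (@exact_submod_closed R Y n) w); rewrite cohomology_mapE; exact/lquotP.
Qed.

Fact const_mono m n (i j : 'I_m.+1) : (i <= j)%N -> ((ord0 : 'I_n.+1) <= (ord0 : 'I_n.+1))%N.
Proof. by []. Qed.
Definition const_map m n : ord_map m n := OrdMap (@const_mono m n).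

Lemma boundary0_empty n (t : boundary 0 n) : False.
Proof. by case: t => t [i /(_ ord0)]; rewrite !ord1. Qed.

(** The boundary of a point is empty, so a vertex of [y] alone poses a lifting problem in degree
    [0], solved by surjectivity. *)
Lemma hypercover_inhabited n : hypercover f -> Y n -> inhabited (X 0).
Proof.
move=> hf y; have [M [g [_ gsurj _]]] := hf 0.
have [inv _ _] := model_square_bij M.
pose L := @SMap (boundary 0) (sset_of X) (fun k t => False_rect _ (boundary0_empty t))
  (fun _ _ _ t => False_ind _ (boundary0_empty t)).
pose q : squares f (boundary_incl 0) := @Square R X Y f _ _ (boundary_incl 0) L
  (simplex_map (K := sset_of Y) (smact (const_map 0 n) y))
  (fun _ t => False_ind _ (boundary0_empty t)).
by have [x _] := gsurj (inv q); exists; exact: x.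
Qed.

End Cohomology.

Theorem theorem6p11 (R : realType) (X Y : smanifold R) (f : smooth_smap X Y)
    (hf : hypercover f) :
  forall n : nat, bijective (cohomology_map f n).
Proof.
(* The default simplices [x0] require a point of [X 0]. Without one, all levels of [X] and [Y] are
   empty and every cochain is zero. *)
move=> n; have [[pt]|nX] := pselect (inhabited (X 0)); last first.
  have Y0 (h : Cinf (Y n)) : h = 0.
    by apply: CinfE => y; case: nX; exact: hypercover_inhabited hf y.
  have X0 (h : Cinf (X n)) : h = 0.
    by apply: CinfE => x; case: nX; exists; exact: (smact (const_map 0 n) x).
  apply: cohomology_map_bij => [z _|z]; last exists 0.
    by rewrite (_ : z = 0) ?(exact_submod_closed Y n).1//; apply: val_inj; exact: Y0.
  rewrite (_ : _ - z = 0) ?(exact_submod_closed X n).1//; apply: val_inj; exact: X0.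
pose x0 k : X k := smact (const_map k 0) pt.
pose K k := sval (cid (hypercover_kernel hf k)).
have HK k : boundary_kernel (K k) := svalP (cid (hypercover_kernel hf k)).
apply: cohomology_map_bij => z.
  move=> /asboolP bz; apply/asboolP.
  (* Injectivity: [z] is [Avg] of its pullback, and [Avg] carries a primitive of the pullback to a
     primitive of [z]. *)
  rewrite -(Avg_cochain_map HK x0 (val z)); case: n z bz => [|n] z /=.
    by move=> ->; exact: Avg0.
  by move=> [g _ <-]; exists (Avg HK x0 g) => //; exact: delta_Avg.
(* Surjectivity: the class of [Avg z] is the preimage, the homotopy giving a primitive of the
   difference in positive degree. *)
have dz := eqP (cocycleP z).
have cA : Avg HK x0 z \in @cocycle R Y n.
  by apply/eqP; rewrite delta_Avg dz; exact: Avg0.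
exists (MkCocycle cA); apply/asboolP; case: n z dz cA => [|n] z dz cA /=.
  by rewrite (Avg_cocycle0 HK x0 dz) subrr.
exists ((-1) ^+ n.+1 *: homotopy HK x0 z) => //.
by rewrite linearZ /=; exact/esym/Avg_cocycleS.
Qed.
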